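(* Let $K$ be an exponential-polynomial decay kernel of order $p$, i.e. $\mu_i\asymp\exp(-\beta i^p)$ for some constant $\beta>0$. Suppose that the step sizes $\{\alpha_t\}_{t\ge0}$ are non-increasing with $0\le\alpha_\tau\le\min\{1,1/\widehat\mu_1\}$ for all $\tau\ge0$, that $\eta_t\to\infty$ as $t\to\infty$, that for $0\le t_1\ll t_2$ as $t_2\to\infty$, $\eta_{t_1}\ll\eta_{t_2}$, and that $p\ge1$. Then at time $T^*$ with $\eta_{T^*}\asymp n(\log n)^{-1/(2p)}$, for any $\varepsilon>0$ there exist constants $C_\varepsilon$ and $N_\varepsilon$ such that, with probability greater than $1-e^{-c_{\beta,p}n(\log n)^{-2/p}}-e^{-c_1(\log n)^{1/p}}$, $$\inf_{n\ge N_\varepsilon}\ \inf_{\substack{f\in\mathcal{B}\\ \|f\|_n\ge C_\varepsilon n^{-\frac12}(\log n)^{\frac1{4p}}}}P_f(\phi_{n,T^*}=1\mid\boldsymbol{x})\ \ge\ 1-\varepsilon,$$ where $c_{\beta,p}$ is an absolute constant depending on $\beta,p$, and $c_1$ is a constant.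
   Context: Model: $y_i=f(x_i)+\epsilon_i$, $i=1,\dots,n$, where $x_i\in\mathcal{X}\subset\mathbb{R}^d$ ($d\ge1$ fixed) are i.i.d. random covariates with distribution $P_X$, and the $\epsilon_i$ are i.i.d. Gaussian noise, independent of the covariates, with mean zero and variance $\sigma^2=1$. Write $\boldsymbol{x}=(x_1,\dots,x_n)$, $\boldsymbol{y}=(y_1,\dots,y_n)^\top$. The function $f$ lies in a reproducing kernel Hilbert space $\mathcal{H}\subset L^2(P_X)$ with reproducing kernel $K$ having Mercer expansion $K(x,x')=\sum_{i\ge1}\mu_i\phi_i(x)\phi_i(x')$, $\mu_1\ge\mu_2\ge\cdots\ge0$, with $\langle\phi_i,\phi_j\rangle_{L^2(P_X)}=\delta_{ij}$ and $\langle\phi_i,\phi_j\rangle_{\mathcal{H}}=\delta_{ij}/\mu_i$. Assumed throughout: there is a finite constant $c_K>0$ with $\sup_{j}\|\phi_j\|_{\sup}\le c_K$. Empirical norm: $\|f\|_n^2=\frac1n\sum_{i=1}^nf(x_i)^2$. $\mathcal{B}=\{f\in\mathcal{H}:\|f\|_{\mathcal{H}}\le C\}$ for a constant $C$. $P_f$ is the probability measure under $f$. Empirical kernel matrix: $[\boldsymbol{K}]_{ij}=\frac1nK(x_i,x_j)$, $\boldsymbol{K}=U\Lambda U^\top$, $UU^\top=I_n$, $\Lambda=\operatorname{diag}(\widehat\mu_1,\dots,\widehat\mu_n)$, $\widehat\mu_1\ge\cdots\ge\widehat\mu_n\ge0$. Gradient descent: with step sizes $\{\alpha_t\}_{t\ge0}$,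 $\boldsymbol{f}_{t}=(f_t(x_1),\dots,f_t(x_n))^\top$ satisfies $\boldsymbol{f}_{t+1}=\boldsymbol{f}_t-\alpha_t\boldsymbol{K}(\boldsymbol{f}_t-\boldsymbol{y})$, with $\boldsymbol{f}_0=0$. Total step size: $\eta_t=\sum_{\tau=0}^{t-1}\alpha_\tau$. Shrinkage matrices: $S^t=\prod_{\tau=0}^{t-1}(I_n-\alpha_\tau\Lambda)$. Here $a\ll b$ means $a/b\to0$, and $a\asymp b$ means equality up to positive multiplicative constants. Testing $H_0:f=0$ against $H_1:f\in\mathcal{H}\setminus\{0\}$: $D_{n,t}=\|f_t\|_n^2$; $\mu_{n,t}=\frac1n\operatorname{tr}((I_n-S^t)^2)$, $\sigma_{n,t}^2=\frac2{n^2}\operatorname{tr}((I_n-S^t)^4)$; the test at significance level $\alpha$ is $\phi_{n,t}=I(|D_{n,t}-\mu_{n,t}|\ge z_{1-\alpha/2}\sigma_{n,t})$, with $z_{1-\alpha/2}$ the $100(1-\alpha/2)$th percentile of the standard normal distribution. Stopping rule: $$T^*=\min\Big\{t\in\mathbb{N}:\ \frac1{\eta_t}<\frac{\sigma}{n}\sqrt{\textstyle\sum_{i=1}^n\min\{1,\eta_t\widehat\mu_i\}}\Big\}.$$ The phrase ''with probability'' refers to the randomness of $\boldsymbol{x}$. *)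

(* Defs.v *)
From HB Require Import structures.
From mathcomp Require Import all_boot all_order all_algebra.
From mathcomp Require Import all_classical all_reals all_analysis.

Set Implicit Arguments.
Unset Strict Implicit.
Unset Printing Implicit Defensive.

Import Order.TTheory GRing.Theory Num.Theory.
Import numFieldNormedType.Exports.

Local Open Scope classical_set_scope.
Local Open Scope ring_scope.

Section Independence.
Context {R : realType} {dO dE : measure_display} {O : measurableType dO}
  {E : measurableType dE} (P : probability O R).

Definition sample (X : nat -> {RV P >-> E}) (n : nat) (w : O) : n.-tuple E :=
  [tuple X i w | i < n].

Definition mutually_independent (X : nat -> {RV P >-> E}) : Prop :=
  forall (J : seq nat) (A : nat -> set E), uniq J ->
    (forall i, measurable (A i)) ->
    P (\bigcap_(i in [set` J]) (X i @^-1` A i)) =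
    (\prod_(i <- J) P (X i @^-1` A i))%E.

Definition iid_with_law (X : nat -> {RV P >-> E}) (Q : set E -> \bar R) : Prop :=
  (forall i (A : set E), measurable A -> distribution P (X i) A = Q A) /\
  mutually_independent X.

End Independence.

Definition independent_sequences {R : realType} {dO dE dF : measure_display}
    {O : measurableType dO} {E : measurableType dE} {F : measurableType dF}
    (P : probability O R) (X : nat -> {RV P >-> E}) (Y : nat -> {RV P >-> F}) :
    Prop :=
  forall (n : nat) (A : set (n.-tuple E)) (B : set (n.-tuple F)),
    measurable A -> measurable B ->
    P ((sample X n @^-1` A) `&` (sample Y n @^-1` B)) =
    (P (sample X n @^-1` A) * P (sample Y n @^-1` B))%E.

(* An element of the RKHS is an abstract vector f : H, and [ev f] is the
   function on the covariate space that it denotes. Covariates live in a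
   subset [XX] of R^d, so only the values of [ev f] on [XX] are meaningful. *)
Record is_rkhs {R : realType} {d : nat} (XX : set (d.-tuple R))
    (PX : probability (d.-tuple R) R) (H : completeNormedModType R)
    (ip : {dot H for idfun}) (ev : H -> d.-tuple R -> R)
    (K : d.-tuple R -> d.-tuple R -> R) : Prop := IsRKHS {
  rkhs_norm : forall f : H, `|f| ^+ 2 = ip f f ;
  rkhs_ev_linear : forall (a : R) (f g : H) x,
    ev (a *: f + g) x = a * ev f x + ev g x ;
  rkhs_ev_inj : forall f g : H, (forall x, XX x -> ev f x = ev g x) -> f = g ;
  rkhs_L2 : forall f : H, measurable_fun XX (ev f) /\
    (\int[PX]_(x in XX) ((ev f x) ^+ 2)%:E < +oo)%E ;
  rkhs_reproducing : forall x, XX x -> exists kx : H,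
    (forall x', XX x' -> ev kx x' = K x x') /\
    (forall f : H, ip f kx = ev f x) }.

(* [mu i] and [phi i] are the eigenvalue and eigenfunction of index i + 1. *)
Record mercer_expansion {R : realType} {d : nat} (XX : set (d.-tuple R))
    (PX : probability (d.-tuple R) R) (H : completeNormedModType R)
    (ip : {dot H for idfun}) (ev : H -> d.-tuple R -> R)
    (K : d.-tuple R -> d.-tuple R -> R)
    (mu : nat -> R) (phi : nat -> H) : Prop := MercerExpansion {
  mercer_ge0 : forall i, 0 <= mu i ;
  mercer_nonincreasing : forall i, mu i.+1 <= mu i ;
  mercer_sum : forall x x', XX x -> XX x' ->
    series (fun i => mu i * ev (phi i) x * ev (phi i) x') @ \oo --> K x x' ;
  mercer_ortho_L2 : forall i j,
    (\int[PX]_(x in XX) (ev (phi i) x * ev (phi j) x)%:E)%E = ((i == j)%:R)%:E ;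
  mercer_ortho_H : forall i j, ip (phi i) (phi j) = (i == j)%:R / mu i }.

Definition exponential_polynomial_decay {R : realType} (mu : nat -> R)
    (beta p : R) : Prop :=
  exists a b : R, [/\ 0 < a, 0 < b & forall i : nat,
    a * expR (- (beta * i.+1%:R `^ p)) <= mu i <=
    b * expR (- (beta * i.+1%:R `^ p))].

Definition emp_kernel {R : realType} {T : Type} (K : T -> T -> R) (n : nat)
    (xs : n.-tuple T) : 'M[R]_n :=
  \matrix_(i, j) (n%:R^-1 * K (tnth xs i) (tnth xs j)).

Definition spectral_decomposition {R : realType} {n : nat} (A U : 'M[R]_n)
    (lam : 'rV[R]_n) : Prop :=
  [/\ A = U *m diag_mx lam *m U^T, U *m U^T = 1%:M,
      (forall i j : 'I_n, (i <= j)%N -> lam 0 j <= lam 0 i) &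
      (forall i : 'I_n, 0 <= lam 0 i)].

Section GradientDescent.
Context {R : realType} {n : nat}.

Definition emp_norm {T : Type} (xs : n.-tuple T) (g : T -> R) : R :=
  Num.sqrt (n%:R^-1 * \sum_(i < n) (g (tnth xs i)) ^+ 2).

Fixpoint gd_iterate (A : 'M[R]_n) (step : nat -> R) (y : 'cV[R]_n) (t : nat) :
    'cV[R]_n :=
  if t is s.+1 then
    gd_iterate A step y s - step s *: (A *m (gd_iterate A step y s - y))
  else 0.

Definition total_step (step : nat -> R) (t : nat) : R := \sum_(tau < t) step tau.

Definition shrinkage (step : nat -> R) (lam : 'rV[R]_n) (t : nat) : 'M[R]_n :=
  \prod_(tau < t) (1%:M - step tau *: diag_mx lam).

Definition test_stat (A : 'M[R]_n) (step : nat -> R) (y : 'cV[R]_n) (t : nat) :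
    R :=
  n%:R^-1 * \sum_(i < n) (gd_iterate A step y t i 0) ^+ 2.

Definition null_mean (step : nat -> R) (lam : 'rV[R]_n) (t : nat) : R :=
  n%:R^-1 * \tr ((1%:M - shrinkage step lam t) ^+ 2).

Definition null_sd (step : nat -> R) (lam : 'rV[R]_n) (t : nat) : R :=
  Num.sqrt (2 / n%:R ^+ 2 * \tr ((1%:M - shrinkage step lam t) ^+ 4)).

(* The bound by min(1, 1 / lam_1) is split in two so that 1 / 0 means +oo. *)
Record step_conditions (step : nat -> R) (lam : 'rV[R]_n) : Prop :=
  StepConditions {
  step_nonincreasing : forall t, step t.+1 <= step t ;
  step_ge0 : forall t, 0 <= step t ;
  step_le1 : forall t, step t <= 1 ;
  step_le_inv : forall t (i : 'I_n), i = 0%N :> nat -> step t * lam 0 i <= 1 ;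
  total_step_infty : total_step step @ \oo --> +oo ;
  total_step_growth : forall t1 t2 : nat -> nat,
    t2 @ \oo --> \oo ->
    (fun k => (t1 k)%:R / (t2 k)%:R : R) @ \oo --> (0 : R) ->
    (fun k => total_step step (t1 k) / total_step step (t2 k)) @ \oo
      --> (0 : R) }.

(* The noise standard deviation is 1. Positivity of the total step size rules
   out t = 0, where 1 / eta_0 means +oo. *)
Definition stop_criterion (step : nat -> R) (lam : 'rV[R]_n) (t : nat) : Prop :=
  0 < total_step step t /\
  (total_step step t)^-1 <
    n%:R^-1 * Num.sqrt (\sum_(i < n) Num.min 1 (total_step step t * lam 0 i)).

Definition stopping_time (step : nat -> R) (lam : 'rV[R]_n) (T : nat) : Prop :=
  stop_criterion step lam T /\ forall t, (t < T)%N -> ~ stop_criterion step lam t.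

End GradientDescent.

Definition normal_quantile {R : realType} (q : R) : R :=
  inf [set z : R | (q%:E <= normal_prob 0 1 `]-oo, z]%classic)%E].

Definition reject {R : realType} {n : nat} (alpha : R) (A : 'M[R]_n)
    (lam : 'rV[R]_n) (step : nat -> R) (y : 'cV[R]_n) (t : nat) : Prop :=
  normal_quantile (1 - alpha / 2) * null_sd step lam t <=
  `|test_stat A step y t - null_mean step lam t|.

(* Conditional probability, given that the covariates equal [xs], that the
   response vector y_i = g x_i + eps_i lies in [B]. The noise is independent of
   the covariates, so the conditional law of y is that of g xs + eps with xs
   frozen. *)
Definition cond_prob {R : realType} {dO : measure_display} {O : measurableType dO}
    (P : probability O R) (eps : nat -> {RV P >-> R}) {T : Type} (n : nat)
    (xs : n.-tuple T) (g : T -> R) (B : set 'cV[R]_n) : \bar R :=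
  P [set w | B (\col_(i < n) (g (tnth xs i) + eps i w))].

Definition separated_ball {R : realType} {H : completeNormedModType R}
    {T : Type} (ev : H -> T -> R) (C : R) (n : nat) (xs : n.-tuple T) (r : R) :
    set H :=
  [set f | `|f| <= C /\ r <= emp_norm xs (ev f)].

(* Main.v *)
Require Import Defs.
From HB Require Import structures.
From mathcomp Require Import all_boot all_order all_algebra.
From mathcomp Require Import all_classical all_reals all_analysis.
From mathcomp Require Import measurable_realfun.
From mathcomp Require Import ring lra.

(** The test statistic is a quadratic form in the responses. In the eigenbasis
    of the kernel matrix, gradient descent after [t] steps has fitted the
    fraction [1 - s_l] of the coordinate of index [l], where
    [s_l = \prod_(tau < t) (1 - alpha_tau * lam_l)]. Centering by the null mean
    therefore leaves, up to the factor [1 / n], signal plus noise: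

    - the signal is the energy of the fitted part of [f], that is
      [n * ||f||_n^2] up to the bias [\sum_l s_l^2 * f_l^2]. Since
      [lam_l * s_l^2 <= 1 / eta_t], the reproducing property bounds the bias by
      [C^2 * n / eta_t];
    - the noise is a linear plus a quadratic form in independent standard normal
      variables, whose second moment is of the order of the signal plus
      [\sum_l (1 - s_l)^4]. This last sum is also the squared null standard
      deviation up to scaling, and it is at most the effective dimension
      [N(eta) = \sum_l min(1, eta * lam_l)] at [eta = eta_t].

    The stopping rule waits until [eta * sqrt(N(eta))] exceeds [n], which is
    where the bias [n / eta] and the standard deviation [sqrt(N(eta))] balance.
    So everything reduces to the size of the effective dimension: it is of the
    order of [(log n)^(1/p)] for all [eta] between [n^(1/2)] and [n].

    - From above ([kernel_eff_dim_upper]) this holds for every design: each of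
      the first [k] eigenfunctions contributes at most one, the others at most
      [eta] times their trace, and the exponential decay makes this trace
      at most of the order of [1 / n] as soon as [k] exceeds a multiple of
      [(log n)^(1/p)].
    - From below ([kernel_eff_dim_lower]) it holds when the first [k]
      eigenfunctions, for [k] a small multiple of [(log n)^(1/p)], are nearly
      orthonormal in the empirical inner product. This is the only random
      event. The entries of the empirical Gram matrix have variance of order
      [1 / n] and there are at most [(log n)^2] of them, up to a constant, so
      by Markov's inequality the event eventually fails with probability at most
      [n^(-1/2) <= exp(- (log n)^(1/p) / 2)] ([prob_gram_event]).

    Hence the rule stops with [eta] of order [n * (log n)^(-1/(2p))]
    ([stopping_time_rate]), where bias, null standard deviation and noise are
    all of order [(log n)^(1/(2p))], and so is the energy of the separated
    functions, with a constant that can be taken as large as needed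
    ([separation_power]). No concentration stronger than second moments is
    used, neither for the design nor for the noise. *)

Set Implicit Arguments.
Unset Strict Implicit.
Unset Printing Implicit Defensive.

Import Order.TTheory GRing.Theory Num.Theory.
Import numFieldNormedType.Exports.

Local Open Scope classical_set_scope.
Local Open Scope ring_scope.

(** * Independence and product measures *)

Section IndependentPair.
Context {R : realType} {dO d1 d2 : measure_display} {O : measurableType dO}
  {E1 : measurableType d1} {E2 : measurableType d2} (P : probability O R).
Variables (X : {RV P >-> E1}) (Y : {RV P >-> E2}).
Hypothesis indepXY : forall A B, measurable A -> measurable B ->
  P ((X @^-1` A) `&` (Y @^-1` B)) = (P (X @^-1` A) * P (Y @^-1` B))%E.

Let XY w := (X w, Y w).

Let mXY : measurable_fun setT XY.
Proof. exact: measurable_fun_pair. Qed.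

Let XY_RV : {RV P >-> (E1 * E2)%type} := mfun_Sub (mem_set mXY).

Lemma joint_distributionE A : measurable A ->
  (distribution P X \x distribution P Y)%E A = distribution P XY_RV A.
Proof.
apply: product_measure_unique => B C mB mC.
rewrite /= /distribution /= /pushforward -indepXY//.
Qed.

Variables (f : E1 -> R) (g : E2 -> R).
Hypotheses (mf : measurable_fun setT f) (mg : measurable_fun setT g).
Hypothesis (fX : P.-integrable setT (EFin \o (f \o X))).
Hypothesis (gY : P.-integrable setT (EFin \o (g \o Y))).

Let h (z : E1 * E2) : \bar R := (f z.1 * g z.2)%:E.

Let mh : measurable_fun setT h.
Proof.
apply/measurable_EFinP/measurable_funM.
  by apply: measurableT_comp.
by apply: measurableT_comp.
Qed.

Let fX' : (distribution P X).-integrable setT (EFin \o f).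
Proof.
by apply: integrable_pushforward => //; exact/measurable_EFinP.
Qed.

Let gY' : (distribution P Y).-integrable setT (EFin \o g).
Proof.
by apply: integrable_pushforward => //; exact/measurable_EFinP.
Qed.

Let h_int : (distribution P X \x distribution P Y)%E.-integrable setT h.
Proof.
apply/integrable12ltyP => //=.
under eq_integral => x _.
  rewrite /h /=.
  under eq_integral do rewrite normrM EFinM.
  rewrite ge0_integralZl//; last first.
    by apply/measurable_EFinP; exact: measurableT_comp.
  over.
rewrite ge0_integralZr//=.
- by apply: lte_mul_pinfty; rewrite ?integral_ge0// ?ge0_fin_numE ?integral_ge0//;
  [move/integrableP : fX' => []|move/integrableP : gY' => []].
- by apply/measurable_EFinP; exact: measurableT_comp.
- exact: integral_ge0.
Qed.

(** The law of the pair is the product of the laws, so that Tonelli's theorem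
    factors the integral of the modulus. *)
Lemma integrable_indepM :
  P.-integrable setT (EFin \o (fun w => f (X w) * g (Y w))).
Proof.
apply/integrableP; split.
  apply/measurable_EFinP/measurable_funM.
    by apply: (measurableT_comp mf).
  by apply: (measurableT_comp mg).
have /integrableP[_] := h_int.
rewrite (eq_measure_integral (distribution P XY_RV)); last first.
  by move=> A mA _; exact: joint_distributionE.
rewrite ge0_integral_distribution//.
exact: measurableT_comp.
Qed.

Lemma Rintegral_indepM : \int[P]_w (f (X w) * g (Y w)) =
  \int[P]_w f (X w) * \int[P]_w g (Y w).
Proof.
rewrite /Rintegral -fineM; last 2 first.
- exact: (integrable_fin_num measurableT fX).
- exact: (integrable_fin_num measurableT gY).
congr fine.
transitivity (\int[distribution P X \x distribution P Y]_z h z)%E.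
  rewrite (eq_measure_integral (distribution P XY_RV)); last first.
    by move=> A mA _; exact: joint_distributionE.
  rewrite integral_distribution//.
  exact: integrable_indepM.
rewrite -integral12_prod_meas1//.
transitivity (\int[distribution P X]_x
    ((f x)%:E * \int[distribution P Y]_y (g y)%:E))%E.
  apply: eq_integral => x _; rewrite /fubini_F /h /=.
  under eq_integral do rewrite EFinM.
  by rewrite integralZl.
rewrite -[X in (_ * X)%E](integral_distribution (f := EFin \o g))//; last first.
  by apply/measurable_EFinP.
rewrite -[X in (X * _)%E](integral_distribution (f := EFin \o f))//; last first.
  by apply/measurable_EFinP.
have /fineK <- : (\int[distribution P Y]_y (g y)%:E)%E \is a fin_num.
  exact: (integrable_fin_num measurableT gY').
by rewrite integralZr.
Qed.

End IndependentPair.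

Section IndependentSample.
Context {R : realType} {dO dE : measure_display} {O : measurableType dO}
  {E : measurableType dE} (P : probability O R).
Variables (X : nat -> {RV P >-> E}).

Lemma measurable_sample m : measurable_fun setT (sample X m).
Proof.
apply/measurable_fun_tnthP => i; rewrite (_ : _ \o _ = X i :> (O -> E))//.
by apply/funext => w /=; rewrite tnth_mktuple.
Qed.

(** Packages [sample] as a random variable, for which a law is defined. *)
Definition sample_RV m : {RV P >-> m.-tuple E} :=
  mfun_Sub (mem_set (@measurable_sample m)).

Let box m (A : nat -> set E) : set (m.-tuple E) :=
  [set t | forall i : 'I_m, A i (tnth t i)].

Let boxes m : set (set (m.-tuple E)) :=
  [set box A | A in [set A : nat -> set E | forall i, measurable (A i)]].

Let measurable_box m A : (forall i, measurable (A i)) -> measurable (@box m A).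
Proof.
move=> mA.
rewrite (_ : box A = \bigcap_(i in [set: 'I_m]) ((@tnth _ E ^~ i) @^-1` A i)).
  apply: fin_bigcap_measurable => [|i _]; first exact: finite_finset.
  by rewrite -[X in measurable X]setTI; apply: measurable_tnth.
by apply/seteqP; split => t /= At i => [_|]; apply: At.
Qed.

Let boxesE m : @measurable _ (m.-tuple E) = <<s @boxes m >>.
Proof.
apply/seteqP; split.
  apply: smallest_sub; first exact: smallest_sigma_algebra.
  rewrite -bigcup_seq => A /= [i _ [B mB <-]]; apply: sub_sigma_algebra.
  exists (fun j => if j == i :> nat then B else setT).
    by move=> j; case: ifP.
  apply/seteqP; split => t /=.
    by move=> /(_ i); rewrite eqxx.
  by move=> [_ Bt] j; case: ifPn => // /eqP/val_inj ->.
apply: smallest_sub; first exact: sigma_algebra_measurable.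
by move=> _ [A mA <-]; exact: measurable_box.
Qed.

Hypothesis indepX : mutually_independent X.

Let sample_box_indep m A B : (forall i, measurable (A i)) -> measurable B ->
  P ((sample X m @^-1` box A) `&` (X m @^-1` B)) =
  (P (sample X m @^-1` box A) * P (X m @^-1` B))%E.
Proof.
move=> mA mB.
have boxE C : sample X m @^-1` box C = \bigcap_(i in [set` iota 0 m]) (X i @^-1` C i).
  apply/seteqP; split => w /=.
    move=> wC i /=; rewrite mem_iota /= add0n => im.
    by have := wC (Ordinal im); rewrite tnth_mktuple.
  by move=> wC i; rewrite tnth_mktuple; apply: wC; rewrite /= mem_iota /= add0n.
pose A' i := if i == m then B else A i.
have mA' i : measurable (A' i) by rewrite /A'; case: ifP.
have boxA' : sample X m @^-1` box A = sample X m @^-1` box A'.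
  apply/seteqP; split => w /= wA i; have := wA i;
  by rewrite /A' ltn_eqF.
have := indepX (iota_uniq 0 m.+1) mA'.
rewrite -addn1 iotaD add0n big_cat /= big_seq1.
rewrite -indepX ?iota_uniq// -boxE -boxA'.
rewrite (_ : X m @^-1` A' m = X m @^-1` B); last by rewrite /A' eqxx.
move=> <-; congr (P _); rewrite boxA' boxE.
apply/seteqP; split => w /=.
  move=> [wA wB] i; rewrite /= mem_cat => /orP[im|]; first exact: wA.
  by rewrite inE => /eqP ->; rewrite /A' eqxx.
move=> wA; split.
  by move=> i im; apply: wA; rewrite /= mem_cat im.
have := wA m; rewrite /A' eqxx; apply.
by rewrite /= mem_cat inE eqxx orbT.
Qed.

(** Mutual independence only speaks of boxes, but boxes form a pi-system that
    generates the product sigma-algebra. *)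
Lemma sample_indep m A B : measurable A -> measurable B ->
  P ((sample_RV m @^-1` A) `&` (X m @^-1` B)) =
  (P (sample_RV m @^-1` A) * P (X m @^-1` B))%E.
Proof.
move=> mA mB.
have mXB : measurable (X m @^-1` B) by rewrite -[X in measurable X]setTI; apply: measurable_funP.
have PB0 : 0 <= fine (P (X m @^-1` B)) by exact: fine_ge0.
pose m1 : {measure set (m.-tuple E) -> \bar R} :=
  pushforward (mrestr P mXB) (sample_RV m).
pose m2 : {measure set (m.-tuple E) -> \bar R} :=
  mscale (NngNum PB0) (pushforward P (sample_RV m)).
have mS : measurable_fun setT (sample_RV m) by exact: measurable_sample.
suff : m1 mS A = m2 mS A.
  rewrite /m1 /m2 /= /mscale /= /pushforward /mrestr /= => ->.
  by rewrite muleC fineK// fin_num_measure.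
apply: (@measure_unique _ _ _ (@boxes m) (fun=> setT) _ _ _ _ (m1 mS) (m2 mS)) => //.
- exact: boxesE.
- move=> _ _ [C mC <-] [D mD <-]; exists (fun i => C i `&` D i).
    by move=> i; apply: measurableI.
  apply/seteqP; split => t /=.
    by move=> CD; split => i; have [] := CD i.
  by move=> [tC tD] i; split.
- by move=> _; exists (fun=> setT) => //; apply/seteqP; split.
- by rewrite bigcup_const.
- move=> _ [C mC <-]; rewrite /m1 /m2 /= /mscale /= /pushforward /mrestr /=.
  rewrite sample_box_indep// muleC fineK// fin_num_measure//.
- move=> _; rewrite /m1 /= /pushforward /mrestr /= preimage_setT setTI.
  by rewrite (le_lt_trans (probability_le1 _ _))// ltry.
Qed.

End IndependentSample.

(** * Second moment calculus *)

Section SquareIntegrable.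
Context {R : realType} {d : measure_display} {O : measurableType d}
  (P : probability O R).
Implicit Types f g : O -> R.

Definition summable_fun f := P.-integrable setT (EFin \o f).

Definition sqint f :=
  measurable_fun setT f /\ summable_fun (fun w => f w ^+ 2).

Lemma summable_cst (c : R) : summable_fun (fun=> c).
Proof. exact: finite_measure_integrable_cst. Qed.

Lemma summableD f g : summable_fun f -> summable_fun g ->
  summable_fun (fun w => f w + g w).
Proof. by move=> sf sg; exact: (integrableD measurableT sf sg). Qed.

Lemma summableZ (c : R) f : summable_fun f -> summable_fun (fun w => c * f w).
Proof. by move=> sf; exact: (integrableZl measurableT c sf). Qed.

Lemma summable_le f g : measurable_fun setT f -> (forall w, `|f w| <= g w) ->
  summable_fun g -> summable_fun f.
Proof.
move=> mf fg sg; apply: (le_integrable measurableT _ _ sg); first exact/measurable_EFinP.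
by move=> w _ /=; rewrite lee_fin (le_trans (fg w))// ler_norm.
Qed.

Lemma sqintM f g : sqint f -> sqint g -> summable_fun (fun w => f w * g w).
Proof.
move=> [mf sf] [mg sg].
apply: (@summable_le _ (fun w => f w ^+ 2 + g w ^+ 2)); last exact: summableD.
  exact: measurable_funM.
move=> w; rewrite normrM -[f w ^+ 2]real_normK ?num_real// -[g w ^+ 2]real_normK ?num_real//.
have := sqr_ge0 (`|f w| - `|g w|).
by have := normr_ge0 (f w); have := normr_ge0 (g w); nra.
Qed.

Lemma sqint_cst (c : R) : sqint (fun=> c).
Proof. by split => //; exact: summable_cst. Qed.

Lemma sqint_summable f : sqint f -> summable_fun f.
Proof.
move=> sf; have := sqintM sf (sqint_cst 1).
by congr (summable_fun _); apply/funext => w; rewrite mulr1.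
Qed.

Lemma sqintD f g : sqint f -> sqint g -> sqint (fun w => f w + g w).
Proof.
move=> sf sg; split; first by apply: measurable_funD; [case: sf|case: sg].
have := summableD (summableD sf.2 sg.2) (summableZ 2 (sqintM sf sg)).
by congr (summable_fun _); apply/funext => w; ring.
Qed.

Lemma sqintZ (c : R) f : sqint f -> sqint (fun w => c * f w).
Proof.
move=> [mf sf]; split; first exact: measurable_funM.
have := summableZ (c ^+ 2) sf.
by congr (summable_fun _); apply/funext => w; ring.
Qed.

Lemma sqint_sum (I : Type) (r : seq I) (Q : pred I) (F : I -> O -> R) :
  (forall i, sqint (F i)) -> sqint (fun w => \sum_(i <- r | Q i) F i w).
Proof.
move=> sF; elim: r => [|i r IH].
  have := sqint_cst 0; congr sqint.
  by apply/funext => w; rewrite big_nil.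
have [Qi|Qi] := boolP (Q i).
  have := sqintD (sF i) IH; congr sqint.
  by apply/funext => w; rewrite big_cons Qi.
by move: IH; congr sqint; apply/funext => w; rewrite big_cons (negbTE Qi).
Qed.

Lemma meanD f g : summable_fun f -> summable_fun g ->
  \int[P]_w (f w + g w) = \int[P]_w f w + \int[P]_w g w.
Proof. by move=> sf sg; rewrite RintegralD. Qed.

Lemma meanZ (c : R) f : summable_fun f ->
  \int[P]_w (c * f w) = c * \int[P]_w f w.
Proof. by move=> sf; rewrite RintegralZl. Qed.

Lemma mean_cst (c : R) : \int[P]_w c = c.
Proof.
by rewrite Rintegral_cst//= probability_setT mulr1.
Qed.

Lemma mean_le f g : summable_fun f -> summable_fun g -> (forall w, f w <= g w) ->
  \int[P]_w f w <= \int[P]_w g w.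
Proof. by move=> sf sg fg; apply: le_Rintegral. Qed.

Lemma mean_ge0 f : (forall w, 0 <= f w) -> 0 <= \int[P]_w f w.
Proof. by move=> f0; apply: Rintegral_ge0. Qed.

Lemma mean_sqrD f g : sqint f -> sqint g ->
  \int[P]_w (f w + g w) ^+ 2 = \int[P]_w (f w ^+ 2) +
    2 * \int[P]_w (f w * g w) + \int[P]_w (g w ^+ 2).
Proof.
move=> sf sg.
rewrite -meanZ; last exact: sqintM.
rewrite -meanD; [|exact: sf.2|exact/summableZ/sqintM].
rewrite -meanD; [|apply: summableD; [exact: sf.2|exact/summableZ/sqintM]|exact: sg.2].
by apply: eq_Rintegral => w _; ring.
Qed.

Lemma mean_sqrD_le f g : sqint f -> sqint g ->
  \int[P]_w (f w + g w) ^+ 2 <=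
  2 * \int[P]_w (f w ^+ 2) + 2 * \int[P]_w (g w ^+ 2).
Proof.
move=> sf sg; have [_ s2] := sqintD sf sg.
rewrite -!meanZ; [|exact: sg.2|exact: sf.2].
rewrite -meanD; [|exact/summableZ/sf.2|exact/summableZ/sg.2].
apply: mean_le => //.
  by apply: summableD; [exact/summableZ/sf.2|exact/summableZ/sg.2].
by move=> w; have := sqr_ge0 (f w - g w); nra.
Qed.

(** Markov's inequality, in the form that serves both for the design and for
    the noise. *)
Lemma markov_lt f (t : R) (B : set O) : summable_fun f -> (forall w, 0 <= f w) ->
  0 < t -> measurable B -> (forall w, f w < t -> B w) ->
  ((1 - (\int[P]_w f w) / t)%:E <= P B)%E.
Proof.
move=> sf f0 t0 mB fB.
suff : (P (~` B) <= ((\int[P]_w f w) / t)%:E)%E.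
  rewrite probability_setC// -[P B]fineK ?fin_num_measure// -EFinB !lee_fin.
  by lra.
have mC : measurable (~` B) by exact: measurableC.
have PC : P (~` B) = (fine (P (~` B)))%:E by rewrite fineK// fin_num_measure.
rewrite PC lee_fin ler_pdivlMr//.
rewrite mulrC.
have <- : \int[P]_w (t * \1_(~` B) w) = t * fine (P (~` B)).
  rewrite meanZ; last exact: integrable_indic.
  congr (_ * _); rewrite /Rintegral integral_indic// setIT//.
apply: mean_le => //.
- by apply: summableZ; exact: integrable_indic.
- move=> w; rewrite indicE; have [wB|wB] := boolP (w \in ~` B).
    rewrite mulr1 leNgt; apply/negP => /fB.
    by move: wB; rewrite inE.
  by rewrite mulr0.
Qed.

End SquareIntegrable.

Section Past.
Context {R : realType} {dO dE : measure_display} {O : measurableType dO}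
  {E : measurableType dE} (P : probability O R).
Variables (X : nat -> {RV P >-> E}).
Implicit Types f g : O -> R.

(** The functions that depend on the first [m] variables only, hence are
    independent of the variable of index [m]. *)
Definition past m f := exists2 U : m.-tuple E -> R,
  measurable_fun setT U & forall w, f w = U (sample X m w).

Lemma past_cst m (c : R) : past m (fun=> c).
Proof. by exists (fun=> c). Qed.

Lemma pastD m f g : past m f -> past m g -> past m (fun w => f w + g w).
Proof.
move=> [U mU fU] [V mV gV]; exists (fun t => U t + V t).
  exact: measurable_funD.
by move=> w; rewrite fU gV.
Qed.

Lemma pastM m f g : past m f -> past m g -> past m (fun w => f w * g w).
Proof.
move=> [U mU fU] [V mV gV]; exists (fun t => U t * V t).
  exact: measurable_funM.
by move=> w; rewrite fU gV.
Qed.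

Lemma past_coord m i (h : E -> R) : measurable_fun setT h -> (i < m)%N ->
  past m (fun w => h (X i w)).
Proof.
move=> mh im; exists (fun t => h (tnth t (Ordinal im))).
  by apply: (measurableT_comp mh); exact: measurable_tnth.
by move=> w; rewrite tnth_mktuple.
Qed.

Lemma past_sum m (I : Type) (r : seq I) (Q : pred I) (F : I -> O -> R) :
  (forall i, Q i -> past m (F i)) -> past m (fun w => \sum_(i <- r | Q i) F i w).
Proof.
move=> sF; elim: r => [|i r IH].
  have := past_cst m 0; congr past.
  by apply/funext => w; rewrite big_nil.
have [Qi|Qi] := boolP (Q i).
  have := pastD (sF i Qi) IH; congr past.
  by apply/funext => w; rewrite big_cons Qi.
by move: IH; congr past; apply/funext => w; rewrite big_cons (negbTE Qi).
Qed.

Hypothesis indepX : mutually_independent X.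

Lemma past_indepM m f (h : E -> R) : past m f -> summable_fun P f ->
  measurable_fun setT h -> summable_fun P (h \o X m) ->
  summable_fun P (fun w => f w * h (X m w)) /\
  \int[P]_w (f w * h (X m w)) = \int[P]_w f w * \int[P]_w h (X m w).
Proof.
move=> [U mU fU] sf mh sh.
have fE : f = U \o sample_RV X m by apply/funext => w; rewrite fU.
rewrite fE in sf *.
have ind := @sample_indep _ _ _ _ _ _ X indepX m.
split; first exact: (integrable_indepM ind).
exact: (Rintegral_indepM ind).
Qed.

Lemma sqint_past_indepM m f (h : E -> R) : past m f -> sqint P f ->
  measurable_fun setT h -> sqint P (h \o X m) ->
  sqint P (fun w => f w * h (X m w)) /\
  \int[P]_w ((f w * h (X m w)) ^+ 2) =
    \int[P]_w (f w ^+ 2) * \int[P]_w (h (X m w) ^+ 2).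
Proof.
move=> pf [mf sf] mh [mhX shX].
have [] := @past_indepM m (fun w => f w ^+ 2) (fun x => h x ^+ 2) _ sf _ shX.
- by have := pastM pf pf; congr past; apply/funext => w; rewrite expr2.
- exact: measurable_funX.
move=> s e; split.
  split; first by apply: measurable_funM => //; exact: mhX.
  by move: s; congr summable_fun; apply/funext => w; rewrite exprMn.
by rewrite -e; apply: eq_Rintegral => w _; rewrite exprMn.
Qed.

(** Independent centered terms are orthogonal, so that variances add up. *)
Lemma mean_sqr_indep_sum (h : E -> R) (v : R) (m : nat) :
  measurable_fun setT h -> (forall i, sqint P (h \o X i)) ->
  (forall i, \int[P]_w h (X i w) = 0) ->
  (forall i, \int[P]_w (h (X i w) ^+ 2) <= v) ->
  \int[P]_w ((\sum_(i < m) h (X i w)) ^+ 2) <= m%:R * v.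
Proof.
move=> mh sh h0 hv.
have sS k : sqint P (fun w => \sum_(i < k) h (X i w)).
  by apply: (sqint_sum _ _ (F := fun (i : 'I_k) w => h (X i w))) => i; exact: sh.
elim: m => [|m IH].
  under eq_Rintegral do rewrite big_ord0 expr0n.
  by rewrite mean_cst mul0r.
under eq_Rintegral do rewrite big_ord_recr.
rewrite /= mean_sqrD; [|exact: sS|exact: sh].
have pS : past m (fun w => \sum_(i < m) h (X i w)).
  by apply: (past_sum _ (F := fun (i : 'I_m) w => h (X i w))) => i _;
     exact: past_coord.
have [_ ->] := past_indepM pS (sqint_summable (sS m)) mh (sqint_summable (sh m)).
by rewrite h0 !mulr0 addr0 -[in leRHS]natr1 mulrDl mul1r lerD.
Qed.

End Past.

(** * Quadratic forms in independent variables *)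

Section GaussianQuadratic.
Context {R : realType} {dO : measure_display} {O : measurableType dO}
  (P : probability O R).
Variables (X : nat -> {RV P >-> R}) (M : R).
Hypothesis indepX : mutually_independent X.
Hypothesis X_L2 : forall i, sqint P (X i).
Hypothesis X_L4 : forall i, sqint P (fun w => X i w ^+ 2 - 1).
Hypothesis X_mean : forall i, \int[P]_w X i w = 0.
Hypothesis X_var : forall i, \int[P]_w (X i w ^+ 2) = 1.
Hypothesis X_kurt : forall i, \int[P]_w ((X i w ^+ 2 - 1) ^+ 2) <= M.
Variables (c : nat -> R) (b : nat -> nat -> R).

Let lin j w := c j + 2 * \sum_(i < j) b i j * X i w.

(** For a symmetric [b] this is the centered form
    [\sum_i c i * X i + \sum_i \sum_j b i j * (X i * X j - (i == j)%:R)], arranged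
    so that the increment from [m] to [m.+1] is a function of the past times a
    centered variable. *)
Definition quadform_dev m w := \sum_(j < m)
  ((c j + 2 * \sum_(i < j) b i j * X i w) * X j w +
   b j j * (X j w ^+ 2 - 1)).

Let mid : measurable_fun setT (id : R -> R).
Proof. exact: measurable_id. Qed.

Let msq : measurable_fun setT (fun x : R => x ^+ 2 - 1).
Proof. by apply: measurable_funB => //; exact: measurable_funX. Qed.

Let lin_L2 j : sqint P (lin j).
Proof.
apply: sqintD; first exact: sqint_cst.
apply: sqintZ; apply: (sqint_sum _ _ (F := fun (i : 'I_j) w => b i j * X i w)).
by move=> i; exact/sqintZ/X_L2.
Qed.

Let lin_past j : past X j (lin j).
Proof.
apply: pastD; first exact: past_cst.
apply: pastM; first exact: past_cst.
apply: (past_sum _ (F := fun (i : 'I_j) w => b i j * X i w)) => i _.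
apply: pastM; first exact: past_cst.
exact: (past_coord _ mid).
Qed.

Let lin_sqr j : \int[P]_w (lin j w ^+ 2) <=
  2 * c j ^+ 2 + 8 * \sum_(i < j) b i j ^+ 2.
Proof.
have sS k : (k <= j)%N -> sqint P (fun w => \sum_(i < k) b i j * X i w).
  move=> kj; apply: (sqint_sum _ _ (F := fun (i : 'I_k) w => b i j * X i w)).
  by move=> i; exact/sqintZ/X_L2.
have pS k : past X k (fun w => \sum_(i < k) b i j * X i w).
  apply: (past_sum _ (F := fun (i : 'I_k) w => b i j * X i w)) => i _.
  apply: pastM; first exact: past_cst.
  exact: (past_coord _ mid).
have sumE k : (k <= j)%N -> \int[P]_w ((\sum_(i < k) b i j * X i w) ^+ 2) =
    \sum_(i < k) b i j ^+ 2.
  elim: k => [_|k IH kj].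
    under eq_Rintegral do rewrite big_ord0 expr0n.
    by rewrite mean_cst big_ord0.
  under eq_Rintegral do rewrite big_ord_recr.
  rewrite /= mean_sqrD; [|exact/sS/ltnW|exact/sqintZ/X_L2].
  rewrite IH ?(ltnW kj)// big_ord_recr /=; congr (_ + _).
    under eq_Rintegral do rewrite mulrCA.
    have /= sSX := sqintM (sS k (ltnW kj)) (X_L2 k).
    rewrite meanZ//.
    have [_ /= ->] := past_indepM indepX (pS k) (sqint_summable (sS k (ltnW kj))) mid (sqint_summable (X_L2 k)).
    by rewrite X_mean !mulr0 addr0.
  under eq_Rintegral do rewrite exprMn.
  by rewrite meanZ ?X_var ?mulr1//; exact: (X_L2 k).2.
apply: (le_trans (mean_sqrD_le (sqint_cst P (c j)) (sqintZ 2 (sS j (leqnn j))))).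
rewrite mean_cst lerD2l.
under eq_Rintegral do rewrite exprMn.
rewrite meanZ ?sumE//; last exact: (sS j (leqnn j)).2.
by rewrite mulrA; set s := \sum_(i < j) _; lra.
Qed.

Lemma sqint_quadform_dev m : sqint P (quadform_dev m).
Proof.
apply: (sqint_sum _ _ (F := fun (j : 'I_m) w =>
   lin j w * X j w + b j j * (X j w ^+ 2 - 1))) => j.
apply: sqintD; last exact/sqintZ/X_L4.
exact: (sqint_past_indepM indepX (lin_past j) (lin_L2 j) mid (X_L2 j)).1.
Qed.

Let dev_past m : past X m (quadform_dev m).
Proof.
apply: (past_sum _ (F := fun (j : 'I_m) w =>
   lin j w * X j w + b j j * (X j w ^+ 2 - 1))) => j _.
have pX i : (i < m)%N -> past X m (X i) by exact: (past_coord _ mid).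
apply: pastD; apply: pastM; [|exact: pX|exact: past_cst|].
  apply: pastD; first exact: past_cst.
  apply: pastM; first exact: past_cst.
  apply: (past_sum _ (F := fun (i : 'I_j) w => b i j * X i w)) => i _.
  by apply: pastM; [exact: past_cst|apply: pX; exact: ltn_trans (ltn_ord j)].
exact: (past_coord _ msq).
Qed.

(** The increments of the deviation are orthogonal to its past, because the
    new coordinate enters only through the centered variables [X] and [X^2 - 1].
    The two parts of an increment need not be orthogonal to each other, since
    no third moment is prescribed; this costs a factor two. *)
Lemma mean_sqr_quadform_dev m : \int[P]_w (quadform_dev m w ^+ 2) <=
  \sum_(j < m) (4 * c j ^+ 2 + 16 * (\sum_(i < j) b i j ^+ 2) +
     2 * M * b j j ^+ 2).
Proof.
elim: m => [|m IH].
  under eq_Rintegral do rewrite /quadform_dev big_ord0 expr0n.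
  by rewrite mean_cst big_ord0.
have devS w : quadform_dev m.+1 w =
    quadform_dev m w + (lin m w * X m w + b m m * (X m w ^+ 2 - 1)).
  by rewrite /quadform_dev big_ord_recr.
under eq_Rintegral do rewrite devS.
have [lX_L2 lX_sqr] := sqint_past_indepM indepX (lin_past m) (lin_L2 m) mid (X_L2 m).
have bX_L2 := sqintZ (b m m) (X_L4 m).
have sdev := sqint_quadform_dev m.
rewrite mean_sqrD//; last exact: sqintD.
have -> : \int[P]_w (quadform_dev m w *
    (lin m w * X m w + b m m * (X m w ^+ 2 - 1))) = 0.
  have s1 := sqintM sdev lX_L2; have s2 := sqintM sdev bX_L2.
  transitivity (\int[P]_w (quadform_dev m w * lin m w * X m w +
     b m m * (quadform_dev m w * (X m w ^+ 2 - 1)))).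
    by apply: eq_Rintegral => w _; ring.
  have [s3 e3] := past_indepM indepX (pastM (dev_past m) (lin_past m))
    (sqintM sdev (lin_L2 m)) mid (sqint_summable (X_L2 m)).
  have [s4 e4] := past_indepM indepX (dev_past m) (sqint_summable sdev) msq
    (sqint_summable (X_L4 m)).
  rewrite meanD; [|exact: s3|exact: summableZ].
  rewrite meanZ// e3 e4 X_mean mulr0 add0r.
  suff -> : \int[P]_w (X m w ^+ 2 - 1) = 0 by rewrite !mulr0.
  have -> : \int[P]_w (X m w ^+ 2 - 1) = \int[P]_w (X m w ^+ 2) + \int[P]_w (-1).
    rewrite -meanD//; last exact: summable_cst.
    exact: (X_L2 m).2.
  by rewrite X_var mean_cst subrr.
rewrite mulr0 addr0 big_ord_recr /= lerD//.
apply: (le_trans (mean_sqrD_le lX_L2 bX_L2)).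
rewrite lX_sqr X_var mulr1.
under [X in _ + 2 * X]eq_Rintegral do rewrite exprMn.
rewrite meanZ; last exact: (X_L4 m).2.
have := lin_sqr m; have := X_kurt m; have := sqr_ge0 (b m m).
set s := \sum_(i < m) _; set k := \int[P]_w _; set l := \int[P]_w _.
by move=> b0 kM lM; have := ler_wpM2l b0 kM; lra.
Qed.

End GaussianQuadratic.

(** * Moments of the standard normal law *)

Section NormalMoments.
Context {R : realType}.
Local Notation mu := (@lebesgue_measure R).
Local Notation N01 := (@normal_prob R 0 1).
Let phi : R -> R := normal_pdf 0 1.

(** The density that defines [normal_prob] is its Radon-Nikodym derivative
    almost everywhere. *)
Lemma ge0_integral_normal_prob (f : R -> R) : measurable_fun setT f ->
  (forall x, 0 <= f x) ->
  (\int[N01]_x (f x)%:E = \int[mu]_x (f x * phi x)%:E)%E.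
Proof.
move=> mf f0.
have dom := @normal_prob_dominates R 0 1.
have f0' x : (0 <= (EFin \o f) x)%E by rewrite lee_fin.
have mf' : measurable_fun setT (EFin \o f) by exact/measurable_EFinP.
rewrite -(Radon_Nikodym_SigmaFinite.change_of_variables dom f0' measurableT mf').
under [RHS]eq_integral do rewrite EFinM.
apply: ae_eq_integral => //.
- apply: emeasurable_funM; first exact/measurable_EFinP.
  exact: measurable_int (Radon_Nikodym_SigmaFinite.f_integrable dom).
- apply: emeasurable_funM; first exact/measurable_EFinP.
  by apply/measurable_EFinP; exact: measurable_normal_pdf.
- apply: ae_eqe_mul2l => /=.
  apply: integral_ae_eq => //=.
  + exact: Radon_Nikodym_SigmaFinite.f_integrable.
  + by apply/measurable_EFinP; exact: measurable_normal_pdf.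
  + by move=> E E01 mE; rewrite -Radon_Nikodym_SigmaFinite.f_integral.
Qed.

Lemma ge0_integralT_opp (f : R -> \bar R) : measurable_fun setT f ->
  (forall x, 0 <= f x)%E -> (\int[mu]_x f x = \int[mu]_x f (- x)%R)%E.
Proof.
move=> mf f0.
transitivity (\int[pushforward mu (-%R : R -> measurableTypeR R)]_x f x)%E.
  by apply: eq_measure_integral => A mA _; exact/esym/lebesgue_measureN.
by rewrite ge0_integral_pushforward.
Qed.

Let phi_ge0 x : 0 <= phi x. Proof. exact: normal_pdf_ge0. Qed.

Let mphi : measurable_fun setT phi. Proof. exact: measurable_normal_pdf. Qed.

Let phiE x : phi x = normal_peak 1 * expR (- (x ^+ 2) / 2).
Proof.
rewrite /phi normal_pdfE ?oner_eq0// /normal_fun subr0 expr1n.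
by rewrite mulr2n.
Qed.

Let phiN x : phi (- x) = phi x. Proof. by rewrite !phiE sqrrN. Qed.

(** [x ^+ 4 * exp (- x ^+ 2 / 4)] is bounded, so that the integrand is at most a
    multiple of the normal density of variance 2. *)
Lemma normal_fourth_moment_lty :
  (\int[N01]_x ((x ^+ 4)%:E) < +oo)%E.
Proof.
(* The bound is 32, since [1 + y ^+ 2 / 2 <= exp y] at [y = x ^+ 2 / 4]. *)
have s0 : Num.sqrt 2 != 0 :> R by rewrite sqrtr_eq0 -ltNge.
have k0 : 0 < normal_peak (Num.sqrt 2) :> R by exact: normal_peak_gt0.
have m4 : measurable_fun setT (fun x : R => x ^+ 4) by exact: measurable_funX.
pose C : R := 32 * normal_peak 1 / normal_peak (Num.sqrt 2).
have x4_ge0 (x : R) : 0 <= x ^+ 4 by rewrite exprn_even_ge0.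
rewrite ge0_integral_normal_prob//.
apply: (@le_lt_trans _ _ (\int[mu]_x (C%:E * (normal_pdf 0 (Num.sqrt 2) x)%:E))%E).
  apply: ge0_le_integral => //.
  - by move=> x _; rewrite lee_fin mulr_ge0.
  - by apply/measurable_EFinP/measurable_funM.
  - apply: emeasurable_funM => //.
    by apply/measurable_EFinP; exact: measurable_normal_pdf.
  - move=> x _; rewrite -EFinM lee_fin phiE normal_pdfE// /normal_fun.
    rewrite subr0 sqr_sqrtr// /C.
    set k2 := normal_peak (Num.sqrt 2) in k0 *.
    have -> : 32 * normal_peak 1 / k2 * (k2 * expR (- x ^+ 2 / (2 *+ 2))) =
        32 * normal_peak 1 * expR (- x ^+ 2 / (2 *+ 2)) by field; exact: lt0r_neq0.
    have -> : - x ^+ 2 / 2 = - x ^+ 2 / (2 *+ 2) + - x ^+ 2 / (2 *+ 2).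
      by rewrite mulr2n; field.
    rewrite expRD; set e := expR _.
    have e0 : 0 < e by exact: expR_gt0.
    have x4 : x ^+ 4 * e <= 32.
      have -> : e = (expR (x ^+ 2 / (2 *+ 2)))^-1.
        by rewrite -expRN /e mulNr.
      rewrite ler_pdivrMr ?expR_gt0//.
      have := @expR_ge1Dxn R (x ^+ 2 / (2 *+ 2)) 1.
      rewrite divr_ge0 ?sqr_ge0// ?mulr2n => /(_ isT).
      move=> hE; have {hE} : 1 + (x ^+ 2 / (2 + 2)) ^+ 2 / 2 <= expR (x ^+ 2 / (2 + 2)) by exact: hE.
      set E := expR _.
      rewrite (_ : x ^+ 4 = (x ^+ 2) ^+ 2); last by rewrite -exprM.
      set y := x ^+ 2.
      rewrite (_ : (y / (2 + 2)) ^+ 2 / 2 = y ^+ 2 / 32); last by field.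
      by have := sqr_ge0 y; lra.
    have p0 : 0 <= normal_peak 1 :> R by exact: normal_peak_ge0.
    rewrite [leLHS](_ : _ = (normal_peak 1 * e) * (x ^+ 4 * e)); last by ring.
    rewrite [leRHS](_ : _ = (normal_peak 1 * e) * 32); last by ring.
    by rewrite ler_wpM2l// mulr_ge0// ltW.
rewrite integralZl//; last exact: integrable_normal_pdf.
by rewrite integral_normal_pdf mule1 ltry.
Qed.

Lemma sqint_normal_sqr : sqint N01 (fun x => x ^+ 2).
Proof.
split; first exact: measurable_funX.
apply/integrableP; split.
  by apply/measurable_EFinP; apply: measurable_funX; exact: measurable_funX.
under eq_integral => x _.
  rewrite /= ger0_norm ?sqr_ge0// -exprM.
  over.
exact: normal_fourth_moment_lty.
Qed.

Lemma sqint_normal : sqint N01 id.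
Proof. by split; [exact: measurable_id|exact/sqint_summable/sqint_normal_sqr]. Qed.

(** By symmetry [|x| + x] and [|x| - x] have the same mean; this form only
    needs the invariance of nonnegative integrals under [x |-> - x]. *)
Lemma normal_mean : \int[N01]_x x = 0.
Proof.
have s1 := sqint_summable sqint_normal.
have s2 : summable_fun N01 (fun x => `|x|).
  by apply: (integrable_norm s1).
suff : \int[N01]_x (`|x| + x) = \int[N01]_x (`|x| + (-1) * x).
  rewrite meanD// meanD//; last exact: summableZ.
  by rewrite meanZ//; lra.
have norm_ge (x : R) : 0 <= `|x| + x.
  by have := ler_norm (- x); rewrite normrN; lra.
have norm_ge' (x : R) : 0 <= `|x| + (-1) * x.
  by have := ler_norm x; lra.
have m1 : measurable_fun setT (fun x : R => `|x| + x).
  exact: measurable_funD.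
have m2 : measurable_fun setT (fun x : R => `|x| + (-1) * x).
  by apply: measurable_funD => //; exact: measurable_funM.
rewrite /Rintegral ge0_integral_normal_prob// ge0_integral_normal_prob//.
congr fine.
rewrite [RHS]ge0_integralT_opp.
- by apply: eq_integral => x _; rewrite normrN phiN mulrNN mul1r.
- by apply/measurable_EFinP/measurable_funM.
- by move=> x; rewrite lee_fin mulr_ge0.
Qed.

Let bell (x : R) : R := expR (- (x ^+ 2) / 2).

Let bell_ge0 x : 0 <= bell x. Proof. exact: expR_ge0. Qed.

Let is_derive_bell (x : R) : is_derive x 1 bell (- x * bell x).
Proof.
apply: is_derive_eq.
rewrite /GRing.scale /= /bell. by field.
Qed.

Let continuous_bell : continuous bell.
Proof.
move=> x; apply: differentiable_continuous; apply/derivable1_diffP.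
by have [] := is_derive_bell x.
Qed.

Let is_derive_expRN (x : R) : is_derive x 1 (fun y => expR (- y)) (- expR (- x)).
Proof.
by apply: is_derive_eq; rewrite /GRing.scale /=; ring.
Qed.

Let continuous_expRN : continuous (fun y : R => expR (- y)).
Proof.
move=> x; apply: differentiable_continuous; apply/derivable1_diffP.
by have [] := is_derive_expRN x.
Qed.

Let cvg_x_bell : x * bell x @[x --> +oo] --> 0.
Proof.
apply: (@squeeze_cvgr _ _ _ _ (fun=> 0) (fun x => expR (- x))).
- near=> x.
  have x4 : 4 <= x by near: x; exact: nbhs_pinfty_ge.
  have x0 : 0 <= x by lra.
  rewrite mulr_ge0 ?bell_ge0//=.
  apply: (@le_trans _ _ (expR x * expR (- (2 * x)))).
    apply: ler_pM; [exact: x0|exact: bell_ge0| |].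
      by have := expR_ge1Dx x; lra.
    by rewrite ler_expR; nra.
  by rewrite -expRD ler_expR; lra.
- exact: cvg_cst.
- exact: cvgr_expR.
Unshelve. all: by end_near. Qed.

(** The difference of the integrands has the antiderivative
    [- x * exp (- x ^+ 2 / 2)]. It changes sign at 1, so [exp (1 - x)] is added to
    both sides to stay within the fundamental theorem of calculus for
    nonnegative functions on a half-line. *)
Lemma integral_sqr_bell :
  (\int[mu]_(x in `[0%R, +oo[) (x ^+ 2 * bell x)%:E =
   \int[mu]_(x in `[0%R, +oo[) (bell x)%:E)%E.
Proof.
pose e := expR 1 : R.
pose g (x : R) : R := e * expR (- x).
pose f (x : R) : R := (x ^+ 2 - 1) * bell x + g x.
pose F (x : R) : R := - (x * bell x) + - (e * expR (- x)).
have g0 x : 0 <= g x by rewrite mulr_ge0 ?expR_ge0.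
have cg : continuous g.
  by move=> x; apply: cvgM; [exact: cvg_cst|exact: continuous_expRN].
have csqr : continuous (fun x : R => x ^+ 2) by exact: exprn_continuous.
have cf : continuous f.
  move=> x; apply: cvgD; last exact: cg.
  apply: cvgM; last exact: continuous_bell.
  by apply: cvgB; [exact: csqr|exact: cvg_cst].
have f0 x : 0 <= x -> 0 <= f x.
  move=> x0; rewrite /f.
  have [x1|x1] := leP 1 x.
    by rewrite addr_ge0// mulr_ge0//; nra.
  have : 1 <= g x by rewrite /g /e -expRD -[leLHS]expR0 ler_expR; lra.
  have : bell x <= 1 by rewrite /bell -[leRHS]expR0 ler_expR; nra.
  by have := bell_ge0 x; nra.
have dF (x : R) : is_derive x 1 F (f x).
  by apply: is_derive_eq; rewrite /GRing.scale /= /f /g /bell; field.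
have dG (x : R) : is_derive x 1 (fun y => - (e * expR (- y))) (g x).
  by apply: is_derive_eq; rewrite /GRing.scale /= /g; ring.
have G_oo : - (e * expR (- x)) @[x --> +oo] --> 0.
  
  rewrite -[0]oppr0 -[in X in _ --> - X](mulr0 e); apply: cvgN; apply: cvgM.
    exact: cvg_cst.
  exact: cvgr_expR.
have intg : (\int[mu]_(x in `[0%R, +oo[) (g x)%:E = e%:E)%E.
  rewrite (@ge0_continuous_FTC2y _ g (fun y => - (e * expR (- y))) 0 0)//.
  - by rewrite oppr0 expR0 mulr1 -EFinB sub0r opprK.
  - exact/continuous_subspaceT.
  - by apply: cvg_at_right_filter; apply: cvgN; exact: cg.
  - by move=> x _; rewrite derive1E; have [_ ->] := dG x.
have intf : (\int[mu]_(x in `[0%R, +oo[) (f x)%:E = e%:E)%E.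
  rewrite (@ge0_continuous_FTC2y _ f F 0 0)//.
  - by rewrite -EFinB /F [- 0]oppr0 expR0; congr EFin; ring.
  - exact/continuous_subspaceT.
  - rewrite -[0]addr0; apply: cvgD => //.
    by rewrite -[0]oppr0; apply: cvgN.
  - apply: cvg_at_right_filter; apply: cvgD; last by apply: cvgN; exact: cg.
    by apply: cvgN; apply: cvgM; [exact: cvg_id|exact: continuous_bell].
  - by move=> x _; rewrite derive1E; have [_ ->] := dF x.
have mfun (h : R -> R) : continuous h ->
    measurable_fun (`[0, +oo[%classic : set R) (EFin \o h).
  move=> ch; apply/measurable_EFinP; apply: measurable_funTS.
  exact: continuous_measurable_fun.
have csb : continuous (fun x : R => x ^+ 2 * bell x).
  by move=> x; apply: cvgM; [exact: csqr|exact: continuous_bell].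
have : (\int[mu]_(x in `[0%R, +oo[) ((x ^+ 2 * bell x)%:E + (g x)%:E) =
        \int[mu]_(x in `[0%R, +oo[) ((bell x)%:E + (f x)%:E))%E.
  by apply: eq_integral => x _; rewrite -!EFinD; congr EFin; rewrite /f; ring.
rewrite ge0_integralD//; last 4 first.
- by move=> x _; rewrite lee_fin mulr_ge0// sqr_ge0.
- exact: mfun.
- by move=> x _; rewrite lee_fin.
- exact: mfun.
rewrite ge0_integralD//; last 4 first.
- by move=> x _; rewrite lee_fin.
- exact: mfun.
- by move=> x /=; rewrite in_itv/= andbT lee_fin; exact: f0.
- exact: mfun.
by rewrite intg intf => eqe; rewrite -[LHS](@addeK _ e%:E)// eqe addeK.
Qed.

Lemma normal_variance : \int[N01]_x (x ^+ 2) = 1.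
Proof.
have m2 : measurable_fun setT (fun x : R => x ^+ 2) by exact: measurable_funX.
rewrite /Rintegral ge0_integral_normal_prob//; last by move=> x; exact: sqr_ge0.
suff -> : (\int[mu]_x (x ^+ 2 * phi x)%:E = \int[mu]_x (phi x)%:E)%E.
  by rewrite integral_normal_pdf.
have p0 : 0 <= normal_peak 1 :> R by exact: normal_peak_ge0.
have cphi : continuous phi by apply: continuous_normal_pdf; exact: oner_neq0.
rewrite [LHS]ge0_symfun_integralT; last 3 first.
- by move=> x; rewrite mulr_ge0// sqr_ge0.
- by move=> x; apply: cvgM; [exact: exprn_continuous|exact: cphi].
- by move=> x /=; rewrite phiN sqrrN.
rewrite [in RHS]ge0_symfun_integralT//; last by move=> x /=; rewrite phiN.
congr (_ * _)%E; rewrite -set_itvcy.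
have mbell : measurable_fun (`[0, +oo[%classic : set R) (EFin \o bell).
  apply/measurable_EFinP; apply: measurable_funTS.
  exact: continuous_measurable_fun.
transitivity ((normal_peak 1)%:E * \int[mu]_(x in `[0%R, +oo[) (x ^+ 2 * bell x)%:E)%E.
  rewrite -ge0_integralZl//.
  - by apply: eq_integral => x _; rewrite -EFinM phiE -/(bell x); congr EFin; ring.
  - apply/measurable_EFinP/measurable_funM; first exact: measurable_funTS.
    by move/measurable_EFinP : mbell.
  - by move=> x _; rewrite lee_fin mulr_ge0// sqr_ge0.
rewrite integral_sqr_bell -ge0_integralZl//.
- by apply: eq_integral => x _; rewrite -EFinM phiE.
- by move=> x _; rewrite lee_fin.
Qed.

End NormalMoments.

(** * Near orthonormality of the empirical Gram matrix *)

Section EqualLaw.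
Context {R : realType} {d d' dE : measure_display} {O : measurableType d}
  {O' : measurableType d'} {E : measurableType dE}
  (P : probability O R) (Q : probability O' R).
Variables (X : {RV P >-> E}) (Y : {RV Q >-> E}).
Hypothesis eq_law : forall A, measurable A ->
  distribution P X A = distribution Q Y A.
Variable g : E -> R.
Hypothesis mg : measurable_fun setT g.

Lemma summable_eq_law : summable_fun Q (g \o Y) -> summable_fun P (g \o X).
Proof.
move=> sg; apply/integrableP; split.
  by apply/measurable_EFinP; exact: measurableT_comp.
have /integrableP[_] := sg.
have mabs : measurable_fun setT (abse \o (EFin \o g)).
  by apply: measurableT_comp => //; exact/measurable_EFinP.
have g0 y : (0 <= (abse \o (EFin \o g)) y)%E by exact: abse_ge0.
rewrite -(ge0_integral_distribution Y mabs g0).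
rewrite (eq_measure_integral (distribution P X)); last first.
  by move=> A mA _; exact/esym/eq_law.
by rewrite (ge0_integral_distribution X mabs g0).
Qed.

Lemma mean_eq_law : summable_fun Q (g \o Y) ->
  \int[P]_w g (X w) = \int[Q]_x g (Y x).
Proof.
move=> sg; have mEg : measurable_fun setT (EFin \o g) by exact/measurable_EFinP.
rewrite /Rintegral; congr fine.
rewrite -(integral_distribution mEg sg).
rewrite (eq_measure_integral (distribution P X)); last first.
  by move=> A mA _; exact/esym/eq_law.
by rewrite integral_distribution//; exact: summable_eq_law.
Qed.

End EqualLaw.


Section GramEvent.
Context {R : realType} {dO dE : measure_display} {O : measurableType dO}
  {E : measurableType dE} (P : probability O R) (Q : probability E R).
Variables (X : nat -> {RV P >-> E}) (psi : nat -> E -> R) (B : R).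
Hypothesis iidX : iid_with_law X Q.
Hypothesis mpsi : forall i, measurable_fun setT (psi i).
Hypothesis psi_bound : forall i x, `|psi i x| <= B.
Hypothesis psi_ortho : forall i j, \int[Q]_x (psi i x * psi j x) = (i == j)%:R.

Definition gram_dev n k (xs : n.-tuple E) (i j : 'I_k) : R :=
  n%:R^-1 * (\sum_(l < n) psi i (tnth xs l) * psi j (tnth xs l)) - (i == j)%:R.

(** The Frobenius distance to the identity is at most 1/2, which puts the
    spectrum of the Gram matrix within [1/2, 3/2]. *)
Definition gram_event n k : set (n.-tuple E) :=
  [set xs | \sum_(i < k) \sum_(j < k) gram_dev xs i j ^+ 2 <= 4^-1].
Arguments gram_event : clear implicits.

Lemma measurable_gram_event n k : measurable (gram_event n k).
Proof.
have mS : measurable_fun setT (fun xs : n.-tuple E =>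
    \sum_(i < k) \sum_(j < k) gram_dev xs i j ^+ 2).
  apply: measurable_sum => i; apply: measurable_sum => j.
  apply: measurable_funX; apply: measurable_funB => //.
  apply: measurable_funM => //; apply: measurable_sum => l.
  by apply: measurable_funM; apply: measurableT_comp => //;
     exact: measurable_tnth.
have := mS measurableT _ (measurable_itv `]-oo, 4^-1]).
by rewrite setTI; congr measurable; apply/seteqP; split => xs /=; rewrite in_itv.
Qed.

Let idQ : {RV Q >-> E} := mfun_Sub (mem_set (@measurable_id _ E setT)).

Let psi2 i j x := psi i x * psi j x - (i == j)%:R.

Let B_ge0 : 0 <= B.
Proof. by apply: le_trans (psi_bound 0 point). Qed.

Let psi2_bound i j x : `|psi2 i j x| <= B ^+ 2 + 1.
Proof.
rewrite (le_trans (ler_normB _ _))// lerD//.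
  by rewrite normrM expr2 ler_pM.
by case: eqP => _; rewrite ?normr1 ?normr0.
Qed.

Let mpsi2 i j : measurable_fun setT (psi2 i j).
Proof. by apply: measurable_funB => //; exact: measurable_funM. Qed.

Let sqint_psi2 i j : sqint Q (psi2 i j).
Proof.
split => //; apply: (summable_le _ _ (summable_cst Q ((B ^+ 2 + 1) ^+ 2))).
  exact: measurable_funX.
move=> x; rewrite normrX ler_sqr ?nnegrE//.
by rewrite addr_ge0// sqr_ge0.
Qed.

Let summable_psiM i j : summable_fun Q (fun x => psi i x * psi j x).
Proof.
apply: (summable_le _ _ (summable_cst Q (B ^+ 2))).
  exact: measurable_funM.
by move=> x; rewrite normrM expr2 ler_pM.
Qed.

Let mean_psi2 i j : \int[Q]_x psi2 i j x = 0.
Proof.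
rewrite meanD//; last exact: summable_cst.
by rewrite psi_ortho mean_cst subrr.
Qed.

(** The entries of the empirical Gram matrix are averages of independent
    bounded variables with the right means, so their squared deviations are of
    order 1/n on average. *)
Lemma prob_gram_event n k : (0 < n)%N ->
  ((1 - (4 * k%:R ^+ 2 * (B ^+ 2 + 1) ^+ 2) / n%:R)%:E <=
   P (sample X n @^-1` gram_event n k))%E.
Proof.
move=> n0; have n0' : 0 < n%:R :> R by rewrite ltr0n.
pose dev i j w := n%:R^-1 * \sum_(l < n) psi2 i j (X l w).
have devE (i j : 'I_k) w : gram_dev (sample X n w) i j = dev i j w.
  rewrite /gram_dev /dev /psi2 sumrB sumr_const card_ord mulrBr.
  congr (_ - _).
    by congr (_ * _); apply: eq_bigr => l _; rewrite tnth_mktuple.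
  by rewrite -(mulr_natr (i == j)%:R) mulrCA mulVf ?mulr1// gt_eqF.
have law l A : measurable A -> distribution P (X l) A = distribution Q idQ A.
  exact: iidX.1.
have sP i j l : sqint P (psi2 i j \o X l).
  split; first exact: measurableT_comp.
  apply: (summable_eq_law (law l) (g := fun x => psi2 i j x ^+ 2)).
    exact: measurable_funX.
  exact: (sqint_psi2 i j).2.
have sdev i j : sqint P (dev i j).
  apply: sqintZ; apply: (sqint_sum _ _ (F := fun (l : 'I_n) w => psi2 i j (X l w))).
  by move=> l; exact: sP.
have mdev i j : \int[P]_w (dev i j w ^+ 2) <= (B ^+ 2 + 1) ^+ 2 / n%:R.
  under eq_Rintegral do rewrite exprMn.
  rewrite meanZ; last first.
    by have [] : sqint P (fun w => \sum_(l < n) psi2 i j (X l w));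
      first (apply: (sqint_sum _ _ (F := fun (l : 'I_n) w => psi2 i j (X l w))) => l;
      exact: sP).
  have := mean_sqr_indep_sum iidX.2 n (mpsi2 i j) (sP i j) _ _ (v := (B ^+ 2 + 1) ^+ 2).
  have h1 l : \int[P]_w psi2 i j (X l w) = 0.
    rewrite (mean_eq_law (law l) (mpsi2 i j)); first exact: mean_psi2.
    exact: (sqint_summable (sqint_psi2 i j)).
  have h2 l : \int[P]_w (psi2 i j (X l w) ^+ 2) <= (B ^+ 2 + 1) ^+ 2.
    rewrite -[leRHS](mean_cst P); apply: mean_le; [exact: (sP i j l).2|exact: summable_cst|].
    move=> w; rewrite -[leLHS]ger0_norm ?sqr_ge0// normrX ler_sqr ?nnegrE//.
    by rewrite addr_ge0// sqr_ge0.
  move=> /(_ h1 h2) h.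
  apply: le_trans (ler_wpM2l _ h) _; first by rewrite exprn_ge0// invr_ge0 ltW.
  by rewrite le_eqVlt; apply/orP; left; apply/eqP; field; exact: lt0r_neq0.
pose f w := \sum_(p : 'I_k * 'I_k) dev p.1 p.2 w ^+ 2.
have ssum (r : seq ('I_k * 'I_k)) : summable_fun P (fun w => \sum_(p <- r) dev p.1 p.2 w ^+ 2) /\
    \int[P]_w (\sum_(p <- r) dev p.1 p.2 w ^+ 2) <=
      (size r)%:R * ((B ^+ 2 + 1) ^+ 2 / n%:R).
  elim: r => [|p r [IHs IH]].
    split.
      have := summable_cst P 0; congr summable_fun.
      by apply/funext => w; rewrite big_nil.
    under eq_Rintegral do rewrite big_nil.
    by rewrite mean_cst mul0r.
  have s2 := (sdev p.1 p.2).2.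
  split.
    have := summableD s2 IHs; congr summable_fun.
    by apply/funext => w; rewrite big_cons.
  under eq_Rintegral do rewrite big_cons.
  by rewrite meanD//= -natr1 mulrDl mul1r addrC lerD.
have [sf mf] : summable_fun P f /\ \int[P]_w f w <=
    k%:R ^+ 2 * ((B ^+ 2 + 1) ^+ 2 / n%:R).
  have [] := ssum (index_enum ('I_k * 'I_k)%type).
  have -> : size (index_enum ('I_k * 'I_k)%type) = (k * k)%N.
    by rewrite -[RHS](congr2 muln (card_ord k) (card_ord k)) -card_prod cardE enumT.
  by rewrite natrM -expr2.
have mB : measurable (sample X n @^-1` gram_event n k).
  rewrite -[X in measurable X]setTI; apply: measurable_sample => //.
  exact: measurable_gram_event.
have fG w : f w < 4^-1 -> (sample X n @^-1` gram_event n k) w.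
  move=> fw; rewrite /gram_event /= pair_bigA/= ltW//.
  by move: fw; congr (_ < _); apply: eq_bigr => -[i j] _ /=; rewrite devE.
apply: le_trans (markov_lt sf _ _ mB fG).
- rewrite lee_fin lerD2l lerN2 ler_pdivrMr// ?invr_gt0//.
  by apply: (le_trans mf); rewrite le_eqVlt; apply/orP; left; apply/eqP; field; exact: lt0r_neq0.
- by move=> w; apply: sumr_ge0 => p _; exact: sqr_ge0.
- by rewrite invr_gt0.
Qed.

End GramEvent.
Arguments gram_event {R dE E} psi n k.

(** * Bounds on the effective dimension *)

Section CauchySchwarzSum.
Context {R : realType}.

Lemma cauchy_schwarz_sum (I : finType) (a b : I -> R) :
  (\sum_i a i * b i) ^+ 2 <= (\sum_i a i ^+ 2) * (\sum_i b i ^+ 2).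
Proof.
set p := \sum_i a i * b i; set A := \sum_i a i ^+ 2; set B := \sum_i b i ^+ 2.
have A0 : 0 <= A by apply: sumr_ge0 => i _; exact: sqr_ge0.
have B0 : 0 <= B by apply: sumr_ge0 => i _; exact: sqr_ge0.
have key (t : R) : 0 <= A - 2 * t * p + t ^+ 2 * B.
  have -> : A - 2 * t * p + t ^+ 2 * B = \sum_i (a i - t * b i) ^+ 2.
    rewrite !mulr_sumr -sumrB -big_split; apply: eq_bigr => i _ /=; ring.
  by apply: sumr_ge0 => i _; exact: sqr_ge0.
have [B_eq0|Bn0] := eqVneq B 0.
  have [->|pn0] := eqVneq p 0; first by rewrite expr0n mulr_ge0.
  have := key ((A + 1) / (2 * p)).
  rewrite B_eq0 mulr0 addr0.
  have -> : 2 * ((A + 1) / (2 * p)) * p = A + 1 by field.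
  by lra.
have Bp : 0 < B by rewrite lt_def Bn0.
have := key (p / B); rewrite -(ler_pM2r Bp) mul0r.
have -> : (A - 2 * (p / B) * p + (p / B) ^+ 2 * B) * B = A * B - p ^+ 2 by field.
by lra.
Qed.

End CauchySchwarzSum.

Section EffectiveDimension.
Context {R : realType} {n : nat}.
Variables (lam : 'I_n -> R).
Hypothesis lam_ge0 : forall l, 0 <= lam l.

(** The hypothesis says that the rank-one form [omega * v v^T] is below the
    form of [lam]; then [v^T (1 + eta * lam)^-1 v] is at most its value for the
    rank-one form itself, which is below [1 / (eta * omega)]. Testing the
    hypothesis at [c = (1 + eta * lam)^-1 v] avoids operator monotonicity. *)
Lemma resolvent_form_le1 (eta omega : R) (v : 'I_n -> R) : 0 <= eta ->
  (forall c : 'I_n -> R,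
    omega * (\sum_l v l * c l) ^+ 2 <= \sum_l lam l * c l ^+ 2) ->
  eta * omega * (\sum_l v l ^+ 2 / (1 + eta * lam l)) <= 1.
Proof.
move=> eta0 hv; pose c l := v l / (1 + eta * lam l).
have d0 l : 0 < 1 + eta * lam l by rewrite ltr_pwDl// mulr_ge0.
set q := \sum_l _.
have qE : q = \sum_l v l * c l by apply: eq_bigr => l _; rewrite /c expr2 mulrA.
have qE2 : q = \sum_l c l ^+ 2 + eta * \sum_l lam l * c l ^+ 2.
  rewrite mulr_sumr -big_split; apply: eq_bigr => l _ /=; rewrite /c; field.
  by rewrite gt_eqF.
have c20 : 0 <= \sum_l c l ^+ 2 by apply: sumr_ge0 => l _; exact: sqr_ge0.
have q0 : 0 <= q.
  by apply: sumr_ge0 => l _; rewrite divr_ge0 ?sqr_ge0// ltW.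
have hq : eta * omega * q ^+ 2 <= q.
  rewrite [leRHS]qE2 [q]qE -mulrA; apply: le_trans (ler_wpM2l eta0 (hv c)) _.
  by rewrite lerDr.
have [->|qn0] := eqVneq q 0; first by rewrite mulr0 ler01.
have qp : 0 < q by rewrite lt_def qn0.
by move: hq; rewrite -[leRHS]mul1r expr2 mulrA ler_pM2r.
Qed.

(** The effective dimension at scale [eta]. Up to a factor two it is the trace
    of [eta * lam * (1 + eta * lam)^-1], which is easier to compare across
    orthonormal bases. *)
Definition eff_dim (eta : R) := \sum_l Num.min 1 (eta * lam l).

Lemma eff_dim_le (eta : R) : 0 <= eta ->
  eff_dim eta <= 2 * \sum_l eta * lam l / (1 + eta * lam l).
Proof.
move=> eta0; rewrite mulr_sumr; apply: ler_sum => l _.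
have x0 : 0 <= eta * lam l by rewrite mulr_ge0.
move: (eta * lam l) x0 => x x0.
rewrite mulrA ler_pdivlMr; last by lra.
by rewrite minEle; case: ifP => [x1|/negbT]; rewrite -?ltNge => *; nra.
Qed.

Lemma eff_dim_ge (eta : R) : 0 <= eta ->
  \sum_l eta * lam l / (1 + eta * lam l) <= eff_dim eta.
Proof.
move=> eta0; apply: ler_sum => l _.
have x0 : 0 <= eta * lam l by rewrite mulr_ge0.
move: (eta * lam l) x0 => x x0.
rewrite ler_pdivrMr; last by lra.
by rewrite minEle; case: ifP => [x1|/negbT]; rewrite -?ltNge => *; nra.
Qed.

Lemma eff_dim_ge0 (eta : R) : 0 <= eta -> 0 <= eff_dim eta.
Proof.
move=> eta0; apply: sumr_ge0 => l _.
by rewrite le_min ler01 mulr_ge0.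
Qed.

Variables (mu : nat -> R) (v : nat -> 'I_n -> R).
Hypothesis mu_ge0 : forall i, 0 <= mu i.
Hypothesis mercer_le : forall k (c : 'I_n -> R),
  \sum_(i < k) mu i * (\sum_l v i l * c l) ^+ 2 <=
  n%:R * \sum_l lam l * c l ^+ 2.

Let n_gt0 (l : 'I_n) : 0 < n%:R :> R.
Proof. by rewrite ltr0n (leq_ltn_trans _ (ltn_ord l)). Qed.

Let resolvent_eigen (eta : R) i : 0 <= eta ->
  eta * mu i * (\sum_l v i l ^+ 2 / (1 + eta * lam l)) <= n%:R.
Proof.
move=> eta0; have [n0|n0] := posnP n.
  rewrite big1 ?mulr0// => l _; have := n_gt0 l.
  by rewrite [X in X%:R]n0 ltxx.
have n0' : 0 < n%:R :> R by rewrite ltr0n.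
have := @resolvent_form_le1 eta (mu i / n%:R) (v i) eta0.
rewrite [X in X * _ <= 1]mulrA mulrAC ler_pdivrMr// mul1r; apply=> c.
rewrite mulrAC ler_pdivrMr// [leRHS]mulrC.
apply: le_trans (mercer_le i.+1 c); rewrite big_ord_recr /= lerDr.
by apply: sumr_ge0 => j _; rewrite mulr_ge0// sqr_ge0.
Qed.

(** Upper bound: each of the first [k] eigenfunctions contributes at most one
    to the effective dimension, and the rest at most [eta] times its trace. *)
Lemma eff_dim_upper (eta : R) (k : nat) (tau : R) : 0 <= eta ->
  n%:R * (\sum_l lam l) <= \sum_(i < k) mu i * (\sum_l v i l ^+ 2) + n%:R * tau ->
  (0 < n)%N -> eff_dim eta <= 2 * (k%:R + eta * tau).
Proof.
move=> eta0 trace n0; have n0' : 0 < n%:R :> R by rewrite ltr0n.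
apply: (le_trans (eff_dim_le eta0)); rewrite ler_pM2l//.
rewrite -(ler_pM2l n0').
pose r l := (1 + eta * lam l)^-1.
have d0 l : 0 < 1 + eta * lam l by rewrite ltr_pwDl// mulr_ge0.
have r0 l : 0 <= r l by rewrite invr_ge0 ltW.
have r1 l : r l <= 1.
  by rewrite invf_le1// lerDl mulr_ge0.
pose D l := n%:R * lam l - \sum_(i < k) mu i * v i l ^+ 2.
have D0 l : 0 <= D l.
  rewrite subr_ge0; have := mercer_le k (fun m => (m == l)%:R).
  rewrite (bigD1 l)//= [X in _ * (_ + X)]big1 ?addr0; last first.
    by move=> m /negbTE ->; rewrite expr0n mulr0.
  rewrite eqxx expr1n mulr1 => h; apply: le_trans h. apply: ler_sum => i _.
  rewrite (bigD1 l)//= big1 ?addr0; last by move=> m /negbTE ->; rewrite mulr0.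
  by rewrite eqxx mulr1.
have DE : \sum_l D l <= n%:R * tau.
  rewrite /D sumrB -mulr_sumr exchange_big /=.
  rewrite lerBlDl; apply: (le_trans trace); rewrite lerD2r.
  by apply: ler_sum => i _; rewrite mulr_sumr.
have -> : n%:R * (\sum_l eta * lam l / (1 + eta * lam l)) =
    eta * (\sum_l D l * r l) +
    \sum_(i < k) eta * mu i * (\sum_l v i l ^+ 2 * r l).
  under [X in _ = _ + X]eq_bigr do rewrite mulr_sumr.
  rewrite exchange_big /= !mulr_sumr -big_split; apply: eq_bigr => l _ /=.
  rewrite /D mulrBl mulrBr mulr_suml mulr_sumr.
  have -> : \sum_(i < k) eta * (mu i * v i l ^+ 2 * r l) =
      \sum_(i < k) eta * mu i * (v i l ^+ 2 * r l).
    by apply: eq_bigr => i _; rewrite !mulrA.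
  by rewrite subrK -/(r l); ring.
rewrite mulrDr addrC lerD//.
  rewrite (_ : n%:R * k%:R = \sum_(i < k) n%:R); last first.
    by rewrite sumr_const card_ord mulr_natr.
  by apply: ler_sum => i _; exact: resolvent_eigen.
rewrite mulrCA ler_wpM2l//; apply: le_trans DE; apply: ler_sum => l _.
by rewrite ler_piMr.
Qed.

(** Lower bound: when the first [k] eigenfunctions are nearly orthonormal in
    the empirical norm, each of them with a large enough eigenvalue contributes
    a constant amount. *)
Lemma eff_dim_lower (eta : R) (k : nat) : 0 <= eta -> (0 < n)%N ->
  \sum_(i < k) \sum_(j < k)
    (n%:R^-1 * (\sum_l v i l * v j l) - (i == j)%:R) ^+ 2 <= 4^-1 ->
  (forall i, (i < k)%N -> 4 <= eta * mu i) ->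
  k%:R / 6 <= eff_dim eta.
Proof.
move=> eta0 n0 gram emu; have n0' : 0 < n%:R :> R by rewrite ltr0n.
apply: le_trans (eff_dim_ge eta0).
pose r l := (1 + eta * lam l)^-1.
have d0 l : 0 < 1 + eta * lam l by rewrite ltr_pwDl// mulr_ge0.
have r0 l : 0 <= r l by rewrite invr_ge0 ltW.
have r1 l : r l <= 1 by rewrite invf_le1// lerDl mulr_ge0.
have ME l : eta * lam l / (1 + eta * lam l) = 1 - r l.
  by rewrite /r; field; rewrite gt_eqF.
under eq_bigr do rewrite ME.
pose g (i j : nat) := n%:R^-1 * (\sum_l v i l * v j l).
pose h (i j : 'I_k) := g i j - (i == j)%:R.
have diag (i : 'I_k) : n%:R / 2 <= \sum_l v i l ^+ 2.
  have : h i i ^+ 2 <= 4^-1.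
    apply: le_trans gram; rewrite (bigD1 i)//= (bigD1 i)//= -addrA lerDl.
    rewrite addr_ge0//; first by apply: sumr_ge0 => j _; exact: sqr_ge0.
    by apply: sumr_ge0 => j _; apply: sumr_ge0 => j' _; exact: sqr_ge0.
  rewrite /h eqxx /g => hi.
  have hi1 : - (1/2) <= n%:R^-1 * (\sum_l v i l * v i l) - 1.
    by move: hi; set x := _ - _; nra.
  have : 2^-1 <= n%:R^-1 * (\sum_l v i l * v i l) by lra.
  rewrite (_ : \sum_l v i l * v i l = \sum_l v i l ^+ 2); last first.
    by apply: eq_bigr => l _; rewrite expr2.
  by rewrite [_^-1 * _]mulrC ler_pdivlMr// mulrC.
(* A leverage score: the Gram matrix has operator norm at most 3/2, tested at
   the vector of the values of the eigenfunctions in the direction [l]. *)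
have leverage l : \sum_(i < k) v i l ^+ 2 <= 3 / 2 * n%:R.
  set S := \sum_(i < k) _.
  have S0 : 0 <= S by apply: sumr_ge0 => i _; exact: sqr_ge0.
  pose T := \sum_(i < k) \sum_(j < k) v i l * v j l * h i j.
  have TE : T = n%:R^-1 * (\sum_m (\sum_(i < k) v i l * v i m) ^+ 2) - S.
    have -> : T = \sum_(i < k) \sum_(j < k) v i l * v j l * g i j - S.
      rewrite /T /S -sumrB; apply: eq_bigr => i _.
      rewrite [X in _ - X](_ : _ = \sum_(j < k) v i l * v j l * (i == j)%:R); last first.
        rewrite (bigD1 i)//= big1 ?addr0; last first.
          by move=> j /negbTE; rewrite eq_sym => ->; rewrite mulr0.
        by rewrite eqxx mulr1 expr2.
      by rewrite -sumrB; apply: eq_bigr => j _; rewrite /h mulrBr.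
    congr (_ - _); rewrite mulr_sumr.
    under [RHS]eq_bigr => m _.
      rewrite expr2 mulr_suml mulr_sumr.
      under eq_bigr do rewrite mulr_sumr mulr_sumr.
      over.
    rewrite [RHS]exchange_big /=; apply: eq_bigr => i _.
    rewrite [RHS]exchange_big /=; apply: eq_bigr => j _.
    by rewrite /g !mulr_sumr; apply: eq_bigr => m _; ring.
  have T2 : T ^+ 2 <= S ^+ 2 / 4.
    rewrite /T pair_bigA /=.
    apply: (le_trans (cauchy_schwarz_sum (fun p : 'I_k * 'I_k => v p.1 l * v p.2 l)
      (fun p => h p.1 p.2))).
    apply: ler_pM.
    - by apply: sumr_ge0 => p _; exact: sqr_ge0.
    - by apply: sumr_ge0 => p _; exact: sqr_ge0.
    - rewrite expr2 /S mulr_suml.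
      under [leRHS]eq_bigr do rewrite mulr_sumr.
      by rewrite pair_bigA /=; apply: ler_sum => p _; rewrite exprMn.
    - by move: gram; rewrite pair_bigA.
  have : n%:R^-1 * S ^+ 2 <= S + T.
    rewrite TE addrCA subrr addr0 ler_pM2l ?invr_gt0//.
    rewrite (bigD1 l)//= [X in (X + _)](_ : _ = S ^+ 2); last first.
      by congr (_ ^+ 2); apply: eq_bigr => i _; rewrite expr2.
    by rewrite lerDl; apply: sumr_ge0 => m _; exact: sqr_ge0.
  have T3 : T <= S / 2 by nra.
  rewrite ler_pdivrMl// => hS.
  have [->|Sn0] := eqVneq S 0; first by rewrite mulr_ge0// ltW.
  have Sp : 0 < S by rewrite lt_def Sn0.
  rewrite -(ler_pM2r Sp) -expr2; apply: (le_trans hS).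
  by nra.
have low : k%:R * n%:R / 4 <= \sum_(i < k) \sum_l v i l ^+ 2 * (1 - r l).
  rewrite (_ : _ / 4 = \sum_(i < k) n%:R / 4); last first.
    by rewrite sumr_const card_ord -mulrA mulr_natl.
  apply: ler_sum => i _; under eq_bigr do rewrite mulrBr mulr1.
  rewrite sumrB; have := diag i.
  have : \sum_l v i l ^+ 2 * r l <= n%:R / 4.
    have := resolvent_eigen i eta0; have := emu i (ltn_ord i).
    have : 0 <= \sum_l v i l ^+ 2 * r l.
      by apply: sumr_ge0 => l _; rewrite mulr_ge0// sqr_ge0.
    rewrite -/(r _); set q := \sum_l v i l ^+ 2 * r l; set m := eta * mu i => q0 m4 mq.
    by rewrite ler_pdivlMr//; apply: le_trans mq; rewrite mulrC ler_wpM2r.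
  by set q := \sum_l v i l ^+ 2 * r l; set q' := \sum_l v i l ^+ 2; lra.
have up : \sum_(i < k) \sum_l v i l ^+ 2 * (1 - r l) <= 3 / 2 * n%:R * \sum_l (1 - r l).
  rewrite exchange_big mulr_sumr /=; apply: ler_sum => l _.
  by rewrite -mulr_suml ler_wpM2r// subr_ge0.
rewrite -(ler_pM2l n0'); have := le_trans low up.
by set s := \sum_l (1 - r l); lra.
Qed.

End EffectiveDimension.

(** * Gradient descent in the eigenbasis *)

Section Eigenbasis.
Context {R : realType} {n : nat}.
Variables (A U : 'M[R]_n) (lam : 'rV[R]_n).
Hypothesis spec : spectral_decomposition A U lam.

Definition eigen_coord (w : 'I_n -> R) (l : 'I_n) : R := \sum_j U j l * w j.

Let UtU : U^T *m U = 1%:M.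
Proof. by apply: mulmx1C; have [] := spec. Qed.

Let UtU_entry l m : \sum_j U j l * U j m = (l == m)%:R.
Proof.
have := congr1 (fun M : 'M[R]_n => M l m) UtU; rewrite !mxE => <-.
by apply: eq_bigr => j _; rewrite mxE.
Qed.

Lemma eigen_col_norm l : \sum_j U j l ^+ 2 = 1.
Proof.
transitivity ((l == l)%:R : R); last by rewrite eqxx.
by rewrite -UtU_entry; apply: eq_bigr => j _; rewrite expr2.
Qed.

Let UUt_entry i j : \sum_l U i l * U j l = (i == j)%:R.
Proof.
have [_ UUt _ _] := spec.
have := congr1 (fun M : 'M[R]_n => M i j) UUt; rewrite !mxE => <-.
by apply: eq_bigr => l _; rewrite mxE.
Qed.

Lemma eigen_coordK (c : 'I_n -> R) l :
  eigen_coord (fun j => \sum_m U j m * c m) l = c l.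
Proof.
rewrite /eigen_coord; under eq_bigr do rewrite mulr_sumr.
rewrite exchange_big /=.
under eq_bigr => m _.
  under eq_bigr do rewrite mulrA.
  rewrite -mulr_suml UtU_entry.
  over.
rewrite (bigD1 l)//= eqxx mul1r big1 ?addr0// => m /negbTE.
by rewrite eq_sym => ->; rewrite mul0r.
Qed.

Lemma eigen_coord_dot (w w' : 'I_n -> R) :
  \sum_l eigen_coord w l * eigen_coord w' l = \sum_j w j * w' j.
Proof.
under eq_bigr => l _.
  rewrite /eigen_coord mulr_suml.
  under eq_bigr do rewrite mulr_sumr.
  over.
rewrite exchange_big /=; apply: eq_bigr => i _.
rewrite exchange_big /=.
under eq_bigr => j _.
  under eq_bigr => l _ do rewrite mulrACA.
  rewrite -mulr_suml UUt_entry.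
  over.
rewrite (bigD1 i)//= eqxx mul1r big1 ?addr0// => m /negbTE.
by rewrite eq_sym => ->; rewrite mul0r.
Qed.

Let A_entry i j : A i j = \sum_l U i l * lam 0 l * U j l.
Proof.
have [-> _ _ _] := spec; rewrite !mxE; apply: eq_bigr => l _.
by rewrite mul_mx_diag !mxE.
Qed.

Lemma eigen_coord_form (w : 'I_n -> R) :
  \sum_i \sum_j w i * w j * A i j = \sum_l lam 0 l * eigen_coord w l ^+ 2.
Proof.
under [RHS]eq_bigr => l _.
  rewrite expr2 /eigen_coord mulr_suml mulr_sumr.
  under eq_bigr do rewrite mulr_sumr mulr_sumr.
  over.
rewrite [RHS]exchange_big /=; apply: eq_bigr => i _.
rewrite [RHS]exchange_big /=; apply: eq_bigr => j _.
by rewrite A_entry mulr_sumr; apply: eq_bigr => l _; ring.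
Qed.

Lemma eigen_trace : \sum_i A i i = \sum_l lam 0 l.
Proof.
under eq_bigr do rewrite A_entry.
rewrite exchange_big /=; apply: eq_bigr => l _.
under eq_bigr do rewrite mulrAC mulrC.
by rewrite -mulr_sumr UtU_entry eqxx mulr1.
Qed.

Lemma eigen_coord_apply (w : 'I_n -> R) l :
  eigen_coord (fun i => \sum_j A i j * w j) l = lam 0 l * eigen_coord w l.
Proof.
have -> : (fun i => \sum_j A i j * w j) =
    (fun i => \sum_m U i m * (lam 0 m * eigen_coord w m)).
  apply/funext => i.
  under eq_bigr do rewrite A_entry mulr_suml.
  rewrite exchange_big /=; apply: eq_bigr => m _.
  by rewrite /eigen_coord !mulr_sumr; apply: eq_bigr => j _; ring.
by rewrite eigen_coordK.
Qed.

End Eigenbasis.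

Section Shrinkage.
Context {R : realType} {n : nat}.
Variables (step : nat -> R) (lam : 'rV[R]_n).

Definition shrink (t : nat) (l : 'I_n) : R :=
  \prod_(tau < t) (1 - step tau * lam 0 l).

Lemma shrinkageE t : shrinkage step lam t = diag_mx (\row_l shrink t l).
Proof.
elim: t => [|t IH].
  rewrite /shrinkage big_ord0 /=.
  by apply/matrixP => i j; rewrite !mxE /shrink big_ord0.
rewrite /shrinkage big_ord_recr -/(shrinkage step lam t) IH /=.
have -> : 1%:M - step t *: diag_mx lam = diag_mx (\row_l (1 - step t * lam 0 l)).
  by apply/matrixP => i j; rewrite !mxE; case: eqP => _; rewrite ?mulr1n ?mulr0n ?mulr0 ?subr0.
rewrite -[_ * _]/(_ *m _) mulmx_diag; congr diag_mx; apply/rowP => l.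
by rewrite !mxE /shrink big_ord_recr.
Qed.

Let shrinkage_subE t :
  1%:M - shrinkage step lam t = diag_mx (\row_l (1 - shrink t l)).
Proof.
rewrite shrinkageE; apply/matrixP => i j; rewrite !mxE.
by case: eqP => _; rewrite ?mulr1n ?mulr0n ?subr0.
Qed.

Let tr_diag_exp (d : 'I_n -> R) k :
  \tr ((diag_mx (\row_l d l) : 'M[R]_n) ^+ k) = \sum_l d l ^+ k.
Proof.
have -> : (diag_mx (\row_l d l) : 'M[R]_n) ^+ k = diag_mx (\row_l d l ^+ k).
  elim: k => [|k IH].
    by apply/matrixP => i j; rewrite !mxE.
  rewrite exprS IH -[_ * _]/(_ *m _) mulmx_diag; congr diag_mx.
  by apply/rowP => l; rewrite !mxE exprS.
by rewrite mxtrace_diag; apply: eq_bigr => l _; rewrite mxE.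
Qed.

Lemma null_meanE t :
  null_mean step lam t = n%:R^-1 * \sum_l (1 - shrink t l) ^+ 2.
Proof. by rewrite /null_mean shrinkage_subE tr_diag_exp. Qed.

Lemma null_sdE t : null_sd step lam t =
  Num.sqrt (2 / n%:R ^+ 2 * \sum_l (1 - shrink t l) ^+ 4).
Proof. by rewrite /null_sd shrinkage_subE tr_diag_exp. Qed.

(** Gradient descent is diagonal in the eigenbasis: it fits the fraction
    [1 - shrink t l] of the coordinate of index [l] of the response. *)
Lemma eigen_coord_gd (A U : 'M[R]_n) (y : 'cV[R]_n) t l :
  spectral_decomposition A U lam ->
  eigen_coord U (fun j => gd_iterate A step y t j 0) l =
  (1 - shrink t l) * eigen_coord U (fun j => y j 0) l.
Proof.
move=> spec; elim: t => [|t IH] /=.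
  rewrite /shrink big_ord0 subrr mul0r /eigen_coord big1// => j _.
  by rewrite mxE mulr0.
set f := gd_iterate A step y t in IH *.
transitivity (eigen_coord U (fun j => f j 0) l - step t *
    eigen_coord U (fun i => \sum_j A i j * (f j 0 - y j 0)) l).
  rewrite /eigen_coord mulr_sumr -sumrB; apply: eq_bigr => j _.
  rewrite !mxE mulrBr; congr (_ - _); rewrite mulrCA; congr (_ * (_ * _)).
  by apply: eq_bigr => i _; rewrite !mxE.
rewrite (eigen_coord_apply spec).
have -> : eigen_coord U (fun j => f j 0 - y j 0) l =
    eigen_coord U (fun j => f j 0) l - eigen_coord U (fun j => y j 0) l.
  by rewrite /eigen_coord -sumrB; apply: eq_bigr => j _; rewrite mulrBr.
rewrite IH /shrink big_ord_recr /=; ring.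
Qed.

Lemma test_statE (A U : 'M[R]_n) (y : 'cV[R]_n) t :
  spectral_decomposition A U lam ->
  test_stat A step y t = n%:R^-1 * \sum_l
    ((1 - shrink t l) * eigen_coord U (fun j => y j 0) l) ^+ 2.
Proof.
move=> spec; rewrite /test_stat; congr (_ * _).
under [RHS]eq_bigr do rewrite -(eigen_coord_gd y t _ spec) expr2.
by rewrite (eigen_coord_dot spec); apply: eq_bigr => j _; rewrite expr2.
Qed.

Hypothesis lam_ge0 : forall l, 0 <= lam 0 l.
Hypothesis step_ge0' : forall t, 0 <= step t.
Hypothesis step_lam : forall t l, step t * lam 0 l <= 1.

Lemma shrink_ge0 t l : 0 <= shrink t l.
Proof. by apply: prodr_ge0 => tau _; rewrite subr_ge0. Qed.

Lemma shrink_le1 t l : shrink t l <= 1.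
Proof.
apply: prodr_ile1 => tau _; rewrite subr_ge0 step_lam /= lerBlDr lerDl.
by rewrite mulr_ge0.
Qed.

Lemma total_step_ge0 t : 0 <= total_step step t.
Proof. by apply: sumr_ge0. Qed.

Lemma total_stepS t : total_step step t.+1 = total_step step t + step t.
Proof. by rewrite /total_step big_ord_recr. Qed.

(** A telescoped form of [1 - x <= 1 / (1 + x)]. *)
Lemma shrink_le_inv t l : shrink t l * (1 + total_step step t * lam 0 l) <= 1.
Proof.
elim: t => [|t IH].
  by rewrite /shrink /total_step !big_ord0 mul0r addr0 mul1r.
rewrite total_stepS /shrink big_ord_recr -/(shrink t l) /=.
have := shrink_ge0 t l; have := step_lam t l; have := step_ge0' t.
have := lam_ge0 l; have := total_step_ge0 t; move: IH.
set s := shrink t l; set e := total_step _ _; set a := step t; set m := lam 0 l.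
move=> IH e0 m0 a0 am1 s0.
have am0 : 0 <= a * m by rewrite mulr_ge0.
have em0 : 0 <= e * m by rewrite mulr_ge0.
apply: le_trans IH; rewrite -mulrA ler_wpM2l//.
have : 0 <= a * m * (e * m) by rewrite mulr_ge0.
by have := sqr_ge0 (a * m); nra.
Qed.

(** Bernoulli's inequality: what has been fitted is at most linear in the total
    step size. *)
Lemma shrink_bernoulli t l : 1 - shrink t l <= total_step step t * lam 0 l.
Proof.
elim: t => [|t IH].
  by rewrite /shrink /total_step !big_ord0 mul0r subrr.
rewrite total_stepS /shrink big_ord_recr -/(shrink t l) /=.
have := shrink_le1 t l; move: IH; rewrite mulrBr mulr1 mulrDl.
have := mulr_ge0 (step_ge0' t) (lam_ge0 l).
set am := step t * lam 0 l; set s := shrink t l; set e := total_step _ _ * _.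
by move=> am0 IH s1; have : s * am <= am; [rewrite ler_piMl|lra].
Qed.

(** What has not been fitted yet lies in directions of eigenvalue at most of the
    order of the inverse total step size. *)
Lemma shrink_bias t l : 0 < total_step step t ->
  lam 0 l * shrink t l ^+ 2 <= (total_step step t)^-1.
Proof.
move=> e0; rewrite -[leRHS]mul1r ler_pdivlMr//.
have := shrink_ge0 t l; have := shrink_le1 t l; have := shrink_le_inv t l.
have := lam_ge0 l; set s := shrink t l; set e := total_step _ _; set m := lam 0 l.
move=> m0 sinv s1 s0.
have : 0 <= e * m by rewrite mulr_ge0// ltW.
have -> : m * s ^+ 2 * e = s * (s * (e * m)) by ring.
move=> em0; have : s * (e * m) <= 1 by nra.
by have : 0 <= s * (e * m); [rewrite mulr_ge0|nra].
Qed.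

End Shrinkage.

(** * The kernel matrix and the reproducing property *)

Lemma cvg_sum_seq {R : realType} (I : Type) (r : seq I) (F : I -> R^nat) (l : I -> R) :
  (forall i, F i @ \oo --> l i) ->
  (fun N => \sum_(i <- r) F i N) @ \oo --> \sum_(i <- r) l i.
Proof.
by move=> Fl; apply: cvg_big => [|i _]; [exact: add_continuous|exact: Fl].
Qed.

Section KernelMatrix.
Context {R : realType} {T : Type} {n : nat}.
Variables (K : T -> T -> R) (xs : n.-tuple T).
Variables (U : 'M[R]_n) (lam : 'rV[R]_n).
Hypothesis spec : spectral_decomposition (emp_kernel K xs) U lam.
Hypothesis n_gt0 : (0 < n)%N.

Definition eval_coord (g : T -> R) (l : 'I_n) : R :=
  eigen_coord U (fun j => g (tnth xs j)) l.

Let nR_gt0 : 0 < n%:R :> R. Proof. by rewrite ltr0n. Qed.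

Lemma kernel_form (w : 'I_n -> R) :
  \sum_i \sum_j w i * w j * K (tnth xs i) (tnth xs j) =
  n%:R * \sum_l lam 0 l * eigen_coord U w l ^+ 2.
Proof.
rewrite -(eigen_coord_form spec) mulr_sumr; apply: eq_bigr => i _.
rewrite mulr_sumr; apply: eq_bigr => j _; rewrite mxE.
by field; rewrite gt_eqF.
Qed.

Lemma kernel_trace :
  \sum_i K (tnth xs i) (tnth xs i) = n%:R * \sum_l lam 0 l.
Proof.
rewrite -(eigen_trace spec) mulr_sumr; apply: eq_bigr => i _.
by rewrite mxE mulrA mulfV ?mul1r// gt_eqF.
Qed.

Section Mercer.
Variables (mu : nat -> R) (psi : nat -> T -> R).
Hypothesis mu_ge0 : forall i, 0 <= mu i.
Hypothesis mercer : forall i j, series (fun m =>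
  mu m * psi m (tnth xs i) * psi m (tnth xs j)) @ \oo -->
  K (tnth xs i) (tnth xs j).

Let mercer_form (w : 'I_n -> R) : series (fun m =>
    mu m * (\sum_j w j * psi m (tnth xs j)) ^+ 2) @ \oo -->
  \sum_i \sum_j w i * w j * K (tnth xs i) (tnth xs j).
Proof.
have -> : series (fun m => mu m * (\sum_j w j * psi m (tnth xs j)) ^+ 2) =
    (fun N => \sum_i \sum_j w i * w j *
      series (fun m => mu m * psi m (tnth xs i) * psi m (tnth xs j)) N).
  apply/funext => N; rewrite /series /=.
  under [LHS]eq_bigr => m _.
    rewrite expr2 big_distrlr /= mulr_sumr.
    under eq_bigr do rewrite mulr_sumr.
    over.
  rewrite [LHS]exchange_big /=; apply: eq_bigr => i _.
  rewrite [LHS]exchange_big /=; apply: eq_bigr => j _.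
  by rewrite mulr_sumr; apply: eq_bigr => m _; ring.
apply: cvg_sum_seq => i; apply: cvg_sum_seq => j.
by apply: cvgM; [exact: cvg_cst|exact: mercer].
Qed.

(** Truncating the Mercer series drops a positive semidefinite form. *)
Lemma mercer_truncation_le k (c : 'I_n -> R) :
  \sum_(i < k) mu i * (\sum_l eval_coord (psi i) l * c l) ^+ 2 <=
  n%:R * \sum_l lam 0 l * c l ^+ 2.
Proof.
pose w j := \sum_l U j l * c l.
have wc l : eigen_coord U w l = c l by rewrite (eigen_coordK spec).
have -> : n%:R * \sum_l lam 0 l * c l ^+ 2 =
    \sum_i \sum_j w i * w j * K (tnth xs i) (tnth xs j).
  by rewrite kernel_form; congr (_ * _); apply: eq_bigr => l _; rewrite wc.
have -> : \sum_(i < k) mu i * (\sum_l eval_coord (psi i) l * c l) ^+ 2 =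
    series (fun m => mu m * (\sum_j w j * psi m (tnth xs j)) ^+ 2) k.
  rewrite /series /= big_mkord; apply: eq_bigr => i _; congr (_ * _ ^+ 2).
  transitivity (\sum_l eval_coord (psi i) l * eigen_coord U w l).
    by apply: eq_bigr => l _; rewrite wc.
  rewrite /eval_coord (eigen_coord_dot spec).
  by apply: eq_bigr => j _; rewrite mulrC.
have cv := @mercer_form w.
rewrite -(cvg_lim _ cv)//; apply: nondecreasing_cvgn_le.
  by apply: nondecreasing_series => m _ _; rewrite mulr_ge0// sqr_ge0.
by apply/cvg_ex; eexists; exact: cv.
Qed.

(** The trace of the remainder of the Mercer series is controlled for every
    design, because the eigenfunctions are uniformly bounded. *)
Lemma mercer_trace_le k (B tau : R) :
  (forall m j, `|psi m (tnth xs j)| <= B) ->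
  (forall N, \sum_(k <= m < N) mu m <= tau) ->
  n%:R * \sum_l lam 0 l <=
  \sum_(i < k) mu i * (\sum_l eval_coord (psi i) l ^+ 2) +
  n%:R * (B ^+ 2 * tau).
Proof.
move=> psiB tail; rewrite -kernel_trace.
have -> : \sum_(i < k) mu i * (\sum_l eval_coord (psi i) l ^+ 2) =
    \sum_j \sum_(i < k) mu i * psi i (tnth xs j) ^+ 2.
  rewrite exchange_big; apply: eq_bigr => i _; rewrite -mulr_sumr; congr (_ * _).
  under eq_bigr do rewrite expr2.
  rewrite /eval_coord (eigen_coord_dot spec).
  by apply: eq_bigr => j _; rewrite expr2.
have -> : n%:R * (B ^+ 2 * tau) = \sum_(j < n) B ^+ 2 * tau.
  by rewrite sumr_const card_ord mulr_natl.
rewrite -big_split /=; apply: ler_sum => j _.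
have mj := @mercer j j; rewrite -(cvg_lim _ mj)//; apply: limr_le.
  by apply/cvg_ex; eexists; exact: mj.
near=> N; rewrite /series /=.
have kN : (k <= N)%N by near: N; exact: nbhs_infty_ge.
rewrite (big_cat_nat _ kN)//= big_mkord lerD//.
  by apply: ler_sum => i _; rewrite -mulrA expr2.
apply: (@le_trans _ _ (\sum_(k <= m < N) B ^+ 2 * mu m)).
  apply: ler_sum => m _; rewrite -mulrA mulrC ler_wpM2r//.
  by rewrite -expr2 -real_normK ?num_real// ler_sqr ?nnegrE// (le_trans _ (psiB m j)).
by rewrite -mulr_sumr ler_wpM2l// sqr_ge0.
Unshelve. all: by end_near. Qed.

End Mercer.

(** The reproducing property bounds every linear functional of the values of
    an element of the space by the kernel form; testing it on the shrunken
    coordinates controls the part of the signal that gradient descent has not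
    yet fitted. *)
Lemma bias_le (g : T -> R) (C eta : R) (s : 'I_n -> R) : 0 < eta ->
  (forall l, 0 <= lam 0 l) ->
  (forall w : 'I_n -> R, (\sum_j w j * g (tnth xs j)) ^+ 2 <=
     C ^+ 2 * \sum_i \sum_j w i * w j * K (tnth xs i) (tnth xs j)) ->
  (forall l, lam 0 l * s l ^+ 2 <= eta^-1) ->
  \sum_l s l ^+ 2 * eval_coord g l ^+ 2 <= C ^+ 2 * n%:R / eta.
Proof.
move=> eta0 lam0 rep bias; set b := \sum_l _.
have b0 : 0 <= b by apply: sumr_ge0 => l _; rewrite mulr_ge0// sqr_ge0.
pose c l := s l ^+ 2 * eval_coord g l.
have := rep (fun j => \sum_l U j l * c l).
rewrite kernel_form -(eigen_coord_dot spec).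
have -> : \sum_l eigen_coord U (fun j => \sum_m U j m * c m) l *
    eigen_coord U (fun j => g (tnth xs j)) l = b.
  by apply: eq_bigr => l _; rewrite (eigen_coordK spec) /c expr2 mulrA.
have le_b : \sum_l lam 0 l * eigen_coord U (fun j => \sum_m U j m * c m) l ^+ 2 <= b / eta.
  rewrite /b mulr_suml; apply: ler_sum => l _; rewrite (eigen_coordK spec) /c.
  have -> : lam 0 l * (s l ^+ 2 * eval_coord g l) ^+ 2 =
      (s l ^+ 2 * eval_coord g l ^+ 2) * (lam 0 l * s l ^+ 2) by ring.
  by rewrite ler_wpM2l// mulr_ge0// sqr_ge0.
set q := \sum_l lam 0 l * _ in le_b *.
move=> bq; have {bq} : b ^+ 2 <= C ^+ 2 * n%:R / eta * b.
  apply: (le_trans bq); rewrite (_ : _ * b = C ^+ 2 * (n%:R * (b / eta))); last by ring.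
  by rewrite ler_wpM2l ?sqr_ge0// ler_wpM2l// ltW.
have [->|bn0] := eqVneq b 0.
  by move=> _; apply: divr_ge0; [apply: mulr_ge0 => //; exact: sqr_ge0|exact: ltW].
by rewrite expr2 ler_pM2r// lt_def bn0.
Qed.

End KernelMatrix.

Section RKHS.
Context {R : realType} {d : nat} {XX : set (d.-tuple R)}
  {PX : probability (d.-tuple R) R} {H : completeNormedModType R}
  {ip : {dot H for idfun}} {ev : H -> d.-tuple R -> R}
  {K : d.-tuple R -> d.-tuple R -> R}.
Hypothesis hH : is_rkhs XX PX ip ev K.

Let ip_norm f : `|f| ^+ 2 = ip f f.
Proof. exact: rkhs_norm hH f. Qed.

Lemma rkhs_cauchy_schwarz (f g : H) : ip f g ^+ 2 <= `|f| ^+ 2 * `|g| ^+ 2.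
Proof.
have sym : ip g f = ip f g by rewrite (hermC ip g f) expr0 mul1r.
have expand (t : R) : `|f + t *: g| ^+ 2 = `|f| ^+ 2 + 2 * t * ip f g + t ^+ 2 * `|g| ^+ 2.
  rewrite !ip_norm linearDl !linearDr /= !linearZl_LR !linearZr_LR /= sym /GRing.scale /=.
  ring.
have [g0|gn0] := eqVneq (`|g| ^+ 2) 0.
  have := sqr_ge0 `|f + (- ((`|f| ^+ 2 + 1) / (2 * ip f g))) *: g|.
  rewrite expand g0 !mulr0 addr0.
  have [->|pn0] := eqVneq (ip f g) 0; first by rewrite expr0n lexx.
  have -> : 2 * - ((`|f| ^+ 2 + 1) / (2 * ip f g)) * ip f g = - (`|f| ^+ 2 + 1).
    by field.
  by lra.
have gp : 0 < `|g| ^+ 2 by rewrite lt_def gn0 sqr_ge0.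
have := sqr_ge0 `|f + (- (ip f g / `|g| ^+ 2)) *: g|.
rewrite expand -(pmulr_lge0 _ gp).
have -> : (`|f| ^+ 2 + 2 * - (ip f g / `|g| ^+ 2) * ip f g +
    (- (ip f g / `|g| ^+ 2)) ^+ 2 * `|g| ^+ 2) * `|g| ^+ 2 = `|f| ^+ 2 * `|g| ^+ 2 - ip f g ^+ 2.
  by field; rewrite -sqrf_eq0.
by lra.
Qed.

(** A linear functional of the values of [f] at the design is the inner product
    of [f] with a combination of the representers, whose squared norm is the
    kernel form. *)
Lemma rkhs_sample_bound (n : nat) (xs : n.-tuple (d.-tuple R)) (f : H)
    (w : 'I_n -> R) : (forall i, XX (tnth xs i)) ->
  (\sum_j w j * ev f (tnth xs j)) ^+ 2 <=
  `|f| ^+ 2 * \sum_i \sum_j w i * w j * K (tnth xs i) (tnth xs j).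
Proof.
move=> xsX.
have /choice[kx kxP] : forall j : 'I_n, exists kx : H,
    (forall x', XX x' -> ev kx x' = K (tnth xs j) x') /\
    (forall f : H, ip f kx = ev f (tnth xs j)).
  by move=> j; exact: rkhs_reproducing hH _ (xsX j).
pose h := \sum_j w j *: kx j.
have fh f' : ip f' h = \sum_j w j * ev f' (tnth xs j).
  rewrite /h linear_sumr; apply: eq_bigr => j _.
  by rewrite linearZr_LR /= (kxP j).2.
have hh : `|h| ^+ 2 = \sum_i \sum_j w i * w j * K (tnth xs i) (tnth xs j).
  rewrite ip_norm fh exchange_big; apply: eq_bigr => j _ /=.
  have -> : ev h (tnth xs j) = \sum_i w i * K (tnth xs i) (tnth xs j).
    rewrite -(kxP j).2 /h linear_sumlz; apply: eq_bigr => i _.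
    by rewrite linearZl_LR /= (kxP j).2 (kxP i).1.
  by rewrite mulr_sumr; apply: eq_bigr => i _; ring.
by rewrite -fh -hh; exact: rkhs_cauchy_schwarz.
Qed.

End RKHS.

(** * Signal and noise in the test statistic *)

Lemma sum_sym_triangular {R : realType} (f : nat -> nat -> R) (n : nat) :
  (forall i j, f i j = f j i) ->
  \sum_(i < n) \sum_(j < n) f i j =
  \sum_(j < n) (2 * \sum_(i < j) f i j + f j j).
Proof.
move=> fC; elim: n => [|n IH]; first by rewrite !big_ord0.
rewrite big_ord_recr [RHS]big_ord_recr -IH /=.
under eq_bigr do rewrite big_ord_recr.
rewrite big_split /= -addrA; congr (_ + _).
rewrite big_ord_recr /= addrA; congr (_ + _).
rewrite mulr_natl mulr2n; congr (_ + _).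
by apply: eq_bigr => i _; exact: fC.
Qed.

Section Power.
Context {R : realType} {dO : measure_display} {O : measurableType dO}
  (P : probability O R).
Variables (eps : nat -> {RV P >-> R}) (M : R).
Hypothesis indep_eps : mutually_independent eps.
Hypothesis eps_L2 : forall i, sqint P (eps i).
Hypothesis eps_L4 : forall i, sqint P (fun w => eps i w ^+ 2 - 1).
Hypothesis eps_mean : forall i, \int[P]_w eps i w = 0.
Hypothesis eps_var : forall i, \int[P]_w (eps i w ^+ 2) = 1.
Hypothesis eps_kurt : forall i, \int[P]_w ((eps i w ^+ 2 - 1) ^+ 2) <= M.

Variables (n : nat) (A U : 'M[R]_n) (lam : 'rV[R]_n).
Hypothesis spec : spectral_decomposition A U lam.
Variables (g : 'I_n -> R) (step : nat -> R) (t : nat).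

Let a l := 1 - shrink step lam t l.
Hypothesis a01 : forall l, 0 <= a l <= 1.

Let signal := \sum_l (a l * eigen_coord U g l) ^+ 2.

Let form (i j : 'I_n) := \sum_l U i l * a l ^+ 2 * U j l.
Let lin (j : 'I_n) := 2 * \sum_l U j l * (a l ^+ 2 * eigen_coord U g l).

(* The sums in [quadform_dev] are indexed by natural numbers, whence the
   extensions by zero of [lin] and [form]. *)
Let ext (f : 'I_n -> R) (i : nat) : R := if insub i is Some i' then f i' else 0.

Let extE f (i : 'I_n) : ext f i = f i.
Proof. by rewrite /ext valK. Qed.

Let c := ext lin.
Let b i j := ext (fun i' => ext (form i') j) i.

Let bE (i j : 'I_n) : b i j = form i j.
Proof. by rewrite /b !extE. Qed.

Let formC i j : form i j = form j i.
Proof. by apply: eq_bigr => l _; ring. Qed.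

Let bC i j : b i j = b j i.
Proof.
rewrite /b /ext; case: insubP => [i' _ _|_]; case: insubP => [j' _ _|_] //.
Qed.

Let dev : O -> R := quadform_dev eps c b n.

Let y w := \col_(i < n) (g i + eps i w).

Let noise w l := eigen_coord U (fun j : 'I_n => eps j w) l.

Let dev_coord w : dev w = \sum_l (2 * (a l ^+ 2 * eigen_coord U g l) * noise w l +
  a l ^+ 2 * (noise w l ^+ 2 - 1)).
Proof.
transitivity (\sum_(j < n) lin j * eps j w +
  (\sum_(i < n) \sum_(j < n) form i j * (eps i w * eps j w) -
   \sum_(j < n) form j j)).
  have -> : \sum_(i < n) \sum_(j < n) form i j * (eps i w * eps j w) =
      \sum_(i < n) \sum_(j < n) b i j * (eps i w * eps j w).
    by apply: eq_bigr => i _; apply: eq_bigr => j _; rewrite bE.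
  rewrite (sum_sym_triangular (f := fun i j => b i j * (eps i w * eps j w))); last first.
    by move=> i j; rewrite bC [eps i w * _]mulrC.
  rewrite -sumrB -big_split; apply: eq_bigr => j _ /=.
  rewrite bE /c extE.
  have -> : \sum_(i < j) b i j * (eps i w * eps j w) =
      (\sum_(i < j) b i j * eps i w) * eps j w.
    by rewrite mulr_suml; apply: eq_bigr => i _; rewrite mulrA.
  by ring.
rewrite [RHS]big_split /=; congr (_ + _).
  rewrite /noise /lin /eigen_coord.
  under [LHS]eq_bigr do rewrite mulr_sumr mulr_suml.
  rewrite [LHS]exchange_big /=; apply: eq_bigr => l _.
  by rewrite [RHS]mulr_sumr; apply: eq_bigr => j _; ring.
under [RHS]eq_bigr do rewrite mulrBr mulr1.
rewrite [RHS]sumrB; congr (_ - _).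
  under [RHS]eq_bigr => l _.
    rewrite /noise /eigen_coord [(\sum_j _) ^+ 2]expr2 big_distrlr /= mulr_sumr.
    under eq_bigr do rewrite mulr_sumr.
    over.
  rewrite [RHS]exchange_big /=; apply: eq_bigr => i _.
  rewrite [RHS]exchange_big /=; apply: eq_bigr => j _.
  by rewrite /form mulr_suml; apply: eq_bigr => l _; ring.
rewrite exchange_big /=; apply: eq_bigr => l _.
under eq_bigr do rewrite mulrAC -expr2.
by rewrite -mulr_suml (eigen_col_norm spec) mul1r.
Qed.

Lemma test_stat_decomposition w : (0 < n)%N ->
  n%:R * (test_stat A step (y w) t - null_mean step lam t) = signal + dev w.
Proof.
move=> n0; rewrite (test_statE step (y w) t spec) null_meanE -mulrBr mulrA.
rewrite mulfV ?mul1r ?pnatr_eq0 -?lt0n//.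
rewrite dev_coord /signal -sumrB -big_split; apply: eq_bigr => l _ /=.
have -> : eigen_coord U (fun j => y w j 0) l = eigen_coord U g l + noise w l.
  rewrite /eigen_coord /noise /eigen_coord -big_split; apply: eq_bigr => j _.
  by rewrite /= mxE mulrDr.
by rewrite -/(a l); ring.
Qed.

Let lin_sqr : \sum_(j < n) c j ^+ 2 <= 4 * signal.
Proof.
under eq_bigr do rewrite /c extE /lin exprMn.
rewrite -mulr_sumr ler_pM//.
  by apply: sumr_ge0 => j _; exact: sqr_ge0.
  by rewrite expr2 -natrM.
pose d l := a l ^+ 2 * eigen_coord U g l.
under eq_bigr do rewrite expr2.
rewrite -(eigen_coord_dot spec).
under eq_bigr do rewrite (eigen_coordK spec).
apply: ler_sum => l _; rewrite -expr2 exprMn [leRHS]exprMn ler_wpM2r ?sqr_ge0//.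
have /andP[a0 a1] := a01 l.
by rewrite -exprM (ler_wiXn2l a0 a1).
Qed.

Let form_sqr : \sum_(i < n) \sum_(j < n) b i j ^+ 2 = \sum_l a l ^+ 4.
Proof.
under eq_bigr do under eq_bigr do rewrite bE.
transitivity (\sum_(i < n) \sum_l (U i l * a l ^+ 2) ^+ 2).
  apply: eq_bigr => i _.
  transitivity (\sum_j (\sum_l U j l * (U i l * a l ^+ 2)) ^+ 2).
    by apply: eq_bigr => j _; congr (_ ^+ 2); apply: eq_bigr => l _; ring.
  under eq_bigr do rewrite expr2.
  rewrite -(eigen_coord_dot spec).
  by apply: eq_bigr => l _; rewrite (eigen_coordK spec) expr2.
rewrite exchange_big /=; apply: eq_bigr => l _.
under eq_bigr do rewrite exprMn -exprM.
by rewrite -mulr_suml (eigen_col_norm spec) mul1r.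
Qed.

Let M_ge0 : 0 <= M.
Proof. by apply: le_trans (eps_kurt 0); apply: mean_ge0 => w; exact: sqr_ge0. Qed.

Let dev_sqr : \int[P]_w (dev w ^+ 2) <= 16 * signal + (16 + 2 * M) * \sum_l a l ^+ 4.
Proof.
apply: (le_trans (mean_sqr_quadform_dev indep_eps eps_L2 eps_L4 eps_mean eps_var eps_kurt c b n)).
rewrite -form_sqr (sum_sym_triangular (f := fun i j => b i j ^+ 2)); last first.
  by move=> i j; rewrite bC.
have lin4 := lin_sqr.
apply: (@le_trans _ _ (4 * (\sum_(j < n) c j ^+ 2) +
    (16 + 2 * M) * \sum_(j < n) (2 * (\sum_(i < j) b i j ^+ 2) + b j j ^+ 2))).
  rewrite [leRHS](_ : _ = \sum_(j < n) (4 * c j ^+ 2 +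
      (16 + 2 * M) * (2 * (\sum_(i < j) b i j ^+ 2) + b j j ^+ 2))); last first.
    by rewrite [RHS]big_split /= -!mulr_sumr.
  apply: ler_sum => j _ /=.
  have : 0 <= \sum_(i < j) b i j ^+ 2 by apply: sumr_ge0 => i _; exact: sqr_ge0.
  have := sqr_ge0 (b j j); set s := \sum_(i < j) _ => b0 s0.
  have := mulr_ge0 M_ge0 s0; lra.
by rewrite lerD2r; move: lin4; set s := \sum_(j < n) c j ^+ 2; lra.
Qed.

Let sqint_dev : sqint P dev.
Proof. exact: sqint_quadform_dev. Qed.

Let measurable_test_stat : measurable_fun setT (fun w => test_stat A step (y w) t).
Proof.
rewrite (_ : (fun w => _) = (fun w => n%:R^-1 * \sum_l
    (a l * eigen_coord U (fun j => y w j 0) l) ^+ 2)); last first.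
  by apply/funext => w; rewrite (test_statE step (y w) t spec).
apply: measurable_funM => //; apply: measurable_sum => l.
apply: measurable_funX; apply: measurable_funM => //.
apply: measurable_sum => j; apply: measurable_funM => //.
rewrite (_ : (fun w => _) = (fun w => g j + eps j w)); last first.
  by apply/funext => w; rewrite mxE.
exact: measurable_funD.
Qed.

(** Chebyshev's inequality for the noise: the test rejects unless the noise
    offsets half of the signal. *)
Lemma reject_power (alpha W N : R) : (0 < n)%N -> 0 < W -> W <= signal ->
  \sum_l a l ^+ 4 <= N ->
  `|normal_quantile (1 - alpha / 2)| * Num.sqrt (2 * N) <= W / 2 ->
  ((1 - (64 / W + (64 + 8 * M) * N / W ^+ 2))%:E <=
   P [set w | reject alpha A lam step (y w) t])%E.
Proof.
move=> n0 W0 WS aN zN; have nR : 0 < n%:R :> R by rewrite ltr0n.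
have S0 : 0 < signal by exact: lt_le_trans WS.
pose z := normal_quantile (1 - alpha / 2) * null_sd step lam t.
have mB : measurable [set w | reject alpha A lam step (y w) t].
  rewrite (_ : [set w | _] =
      (fun w => `|test_stat A step (y w) t - null_mean step lam t|) @^-1` `[z, +oo[).
    rewrite -[X in measurable X]setTI.
    have mf : measurable_fun setT
        (fun w => `|test_stat A step (y w) t - null_mean step lam t|).
      by apply: measurableT_comp => //; exact: measurable_funB.
    exact: mf.
  by apply/seteqP; split => w /=; rewrite in_itv /= andbT.
have zS : n%:R * z <= W / 2.
  apply: le_trans zN; rewrite /z null_sdE mulrCA.
  have -> : n%:R * Num.sqrt (2 / n%:R ^+ 2 * \sum_l (1 - shrink step lam t l) ^+ 4) =
      Num.sqrt (2 * \sum_l a l ^+ 4).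
    rewrite (_ : 2 / n%:R ^+ 2 * _ = n%:R^-1 ^+ 2 * (2 * \sum_l a l ^+ 4)); last first.
      by rewrite -/a; field; exact: lt0r_neq0.
    rewrite sqrtrM ?sqr_ge0// sqrtr_sqr ger0_norm ?invr_ge0 ?ltW//.
    by rewrite mulrA mulfV ?mul1r// gt_eqF.
  rewrite (le_trans (ler_norm _))// normrM ler_wpM2l//.
  by rewrite ger0_norm ?sqrtr_ge0// ler_wsqrtr// ler_pM2l.
have hB w : dev w ^+ 2 < (signal / 2) ^+ 2 -> reject alpha A lam step (y w) t.
  move=> dw; rewrite /reject -/z -(ler_pM2l nR).
  rewrite -[X in _ <= X * _](ger0_norm (ltW nR)) -normrM test_stat_decomposition//.
  apply: (le_trans zS).
  have : `|dev w| < signal / 2.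
    by rewrite -(ltr_sqr) ?nnegrE// ?real_normK ?num_real// ltW// divr_gt0.
  rewrite ltr_norml => /andP[h1 h2].
  by apply: le_trans (ler_norm _); lra.
have t0 : 0 < (signal / 2) ^+ 2 by rewrite exprn_gt0// divr_gt0.
apply: le_trans (markov_lt sqint_dev.2 (fun w => sqr_ge0 _) t0 mB hB).
rewrite lee_fin lerD2l lerN2 ler_pdivrMr//; apply: (le_trans dev_sqr).
have N0 : 0 <= N.
  by apply: le_trans aN; apply: sumr_ge0 => l _; rewrite exprn_even_ge0.
have -> : (64 / W + (64 + 8 * M) * N / W ^+ 2) * (signal / 2) ^+ 2 =
    16 * signal * (signal / W) + (16 + 2 * M) * N * (signal / W) ^+ 2.
  by field; exact: lt0r_neq0.
have r1 : 1 <= signal / W by rewrite ler_pdivlMr// mul1r.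
apply: lerD.
  by rewrite ler_peMr// mulr_ge0// ltW.
have c0 : 0 <= 16 + 2 * M by have := M_ge0; lra.
apply: (@le_trans _ _ ((16 + 2 * M) * N)); first by rewrite ler_wpM2l.
by rewrite ler_peMr ?mulr_ge0// exprn_ege1.
Qed.

End Power.

(** * Rates under exponential-polynomial decay *)

Section DecayRates.
Context {R : realType}.
Variables (beta p : R).
Hypotheses (beta_gt0 : 0 < beta) (p_ge1 : 1 <= p).

Let p_gt0 : 0 < p. Proof. exact: lt_le_trans p_ge1. Qed.
Let pinv_gt0 : 0 < p^-1. Proof. by rewrite invr_gt0. Qed.

Let powR_superadd1 (x : R) : 0 <= x -> x `^ p + 1 <= (x + 1) `^ p.
Proof.
move=> x0; have x10 : 0 <= x + 1 by lra.
rewrite -(mulr_powRB1 x0 p_gt0) -(mulr_powRB1 x10 p_gt0) [leRHS]mulrDl mul1r.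
apply: lerD.
  rewrite ler_wpM2l// ge0_ler_powR ?nnegrE//; last by lra.
  by rewrite subr_ge0.
by rewrite -[leLHS](powRr0 (x + 1)) ler_powR ?subr_ge0//; lra.
Qed.

Let powR_add_nat (k j : nat) : k%:R `^ p + j%:R <= (k + j)%:R `^ p.
Proof.
elim: j => [|j IH]; first by rewrite addr0 addn0.
rewrite addnS -[(k + j).+1%:R]natr1 -[j.+1%:R]natr1 addrA.
by apply: le_trans (powR_superadd1 _) => //; rewrite lerD2r.
Qed.

Let expb_lt1 : 0 < 1 - expR (- beta).
Proof. by rewrite subr_gt0 -[ltRHS]expR0 ltr_expR oppr_lt0. Qed.

(** Consecutive exponents [beta * i `^ p] differ by at least [beta], since the
    power is superadditive; the tail is dominated by a geometric series. *)
Lemma decay_tail (mu : nat -> R) (b : R) (k N : nat) : 0 <= b ->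
  (forall i, mu i <= b * expR (- (beta * i.+1%:R `^ p))) ->
  \sum_(k <= m < N) mu m <=
  b * expR (- (beta * k%:R `^ p)) / (1 - expR (- beta)).
Proof.
move=> b0 hmu; set e := b * _.
have e0 : 0 <= e by rewrite mulr_ge0// expR_ge0.
have [Nk|kN] := leqP N k.
  by rewrite big_geq// divr_ge0// ltW.
rewrite -{1}[k]add0n big_addn big_mkord.
apply: (@le_trans _ _ (\sum_(i < N - k) e * expR (- beta) ^+ i)).
  apply: ler_sum => i _; apply: (le_trans (hmu _)).
  rewrite /e -mulrA ler_wpM2l// -expRM_natl -expRD ler_expR.
  rewrite mulrN -opprD lerN2 [X in _ + X]mulrC -mulrDr ler_pM2l//.
  apply: le_trans (powR_add_nat k i) _.
  rewrite ge0_ler_powR ?nnegrE ?(ltW p_gt0)// ler_nat.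
  by rewrite addnC leqW.
rewrite -mulr_sumr ler_wpM2l// -[leRHS]mul1r ler_pdivlMr//.
have := subrX1 (expR (- beta)) (N - k).
set x := expR (- beta) => eqX.
have : 0 <= x ^+ (N - k) by rewrite exprn_ge0// expR_ge0.
by move: eqX; set s := \sum_(i < N - k) _; nra.
Qed.

Definition eff_dim_const (b B : R) : R :=
  2 * ((beta^-1) `^ p^-1 + 1 + B ^+ 2 * b / (1 - expR (- beta))).

(** An index from which on the eigenvalues are below the order [exp (- L)],
    where [L] stands for [ln n]. *)
Definition upper_cutoff (L : R) : nat :=
  (Num.trunc ((L / beta) `^ p^-1)).+1.

Lemma upper_cutoff_rate (b B L eta : R) (n : nat) : 0 <= b ->
  1 <= L -> n%:R = expR L -> 0 <= eta <= n%:R ->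
  2 * ((upper_cutoff L)%:R + eta * (B ^+ 2 *
    (b * expR (- (beta * (upper_cutoff L)%:R `^ p)) / (1 - expR (- beta))))) <=
  eff_dim_const b B * L `^ p^-1.
Proof.
move=> b0 L1 nL /andP[eta0 etan]; have L0 : 0 <= L by lra.
set k := upper_cutoff L.
have Lb0 : 0 <= L / beta by rewrite divr_ge0// ltW.
have s1 : 1 <= L `^ p^-1 by rewrite -[leLHS](powRr0 L) ler_powR// ltW.
have k_le : k%:R <= (beta^-1) `^ p^-1 * L `^ p^-1 + 1.
  rewrite /k /upper_cutoff -natr1 lerD2r -powRM ?invr_ge0 ?(ltW beta_gt0)// mulrC.
  by rewrite Num.Theory.truncn_le powR_ge0.
have k_ge : L <= beta * k%:R `^ p.
  rewrite mulrC -ler_pdivrMr//.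
  have -> : L / beta = ((L / beta) `^ p^-1) `^ p.
    by rewrite -powRrM mulVf ?gt_eqF// powRr1.
  rewrite ge0_ler_powR ?nnegrE ?powR_ge0 ?(ltW p_gt0)//.
  by rewrite ltW// truncnS_gt.
have c0 : 0 <= B ^+ 2 * b / (1 - expR (- beta)).
  apply: divr_ge0; last exact: ltW.
  by apply: mulr_ge0 => //; exact: sqr_ge0.
have tail : eta * (B ^+ 2 * (b * expR (- (beta * k%:R `^ p)) / (1 - expR (- beta)))) <=
    B ^+ 2 * b / (1 - expR (- beta)).
  rewrite (_ : eta * _ = B ^+ 2 * b / (1 - expR (- beta)) * (eta * expR (- (beta * k%:R `^ p)))); last by ring.
  rewrite ler_piMr//.
  apply: (@le_trans _ _ (expR L * expR (- L))).
    by rewrite ler_pM ?expR_ge0// -?nL// ler_expR lerN2.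
  by rewrite -expRD subrr expR0.
rewrite /eff_dim_const.
move: k_le tail c0.
set t := eta * _; set c := B ^+ 2 * b / _; set u := beta^-1 `^ _; set s := L `^ _ in s1 *.
by move=> *; nra.
Qed.

(** The index up to which the eigenvalues stay above the order
    [exp (- L / 4)]. *)
Definition lower_cutoff (L : R) : nat := Num.trunc ((L / (4 * beta)) `^ p^-1).

Definition lower_const : R := ((4 * beta)^-1) `^ p^-1.

Let lower_powE (L : R) : 0 <= L ->
  (L / (4 * beta)) `^ p^-1 = lower_const * L `^ p^-1.
Proof. by move=> L0; rewrite powRM ?invr_ge0 ?mulr_ge0 ?(ltW beta_gt0)// mulrC. Qed.

Lemma lower_const_gt0 : 0 < lower_const.
Proof. by rewrite powR_gt0// invr_gt0 mulr_gt0. Qed.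

Lemma lower_cutoff_le (L : R) : 1 <= L ->
  (lower_cutoff L)%:R <= lower_const * L.
Proof.
move=> L1; have L0 : 0 <= L by lra.
apply: (@le_trans _ _ ((L / (4 * beta)) `^ p^-1)).
  by rewrite Num.Theory.truncn_le powR_ge0.
rewrite lower_powE// ler_wpM2l ?(ltW lower_const_gt0)//.
by rewrite ler1_powR// invf_le1.
Qed.

Lemma lower_cutoff_ge (L : R) : 4 * beta <= L ->
  lower_const / 2 * L `^ p^-1 <= (lower_cutoff L)%:R.
Proof.
move=> Lb; have b40 : 0 < 4 * beta by rewrite mulr_gt0.
have L0 : 0 <= L by apply: le_trans Lb; exact: ltW.
have x1 : 1 <= (L / (4 * beta)) `^ p^-1.
  by rewrite -[leLHS](powRr0 (L / (4 * beta))) ler_powR ?(ltW pinv_gt0)// ler_pdivlMr// mul1r.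
rewrite mulrAC -lower_powE//.
rewrite /lower_cutoff; set x := _ `^ _ in x1 *.
have := truncnS_gt x; have : (1 <= Num.trunc x)%N by rewrite truncn_gt0.
by rewrite -natr1 -(ler_nat R); lra.
Qed.

(** Below the lower cutoff the eigenvalues are at least of order n^(-1/4),
    hence large against the inverse of any step size beyond n^(1/2). *)
Lemma lower_cutoff_eigen (mu : nat -> R) (a L eta : R) : 0 < a ->
  (forall i, a * expR (- (beta * i.+1%:R `^ p)) <= mu i) ->
  0 <= L -> 16 <= a * L -> expR (L / 2) <= eta ->
  forall i, (i < lower_cutoff L)%N -> 4 <= eta * mu i.
Proof.
move=> a0 hmu L0 aL Leta i ik.
have b40 : 0 < 4 * beta by rewrite mulr_gt0.
have iL : beta * i.+1%:R `^ p <= L / 4.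
  have : i.+1%:R <= (L / (4 * beta)) `^ p^-1.
    apply: (@le_trans _ _ (lower_cutoff L)%:R); first by rewrite ler_nat.
    by rewrite Num.Theory.truncn_le powR_ge0.
  have Lb : 0 <= L / (4 * beta) by rewrite divr_ge0// ltW.
  move=> /(ge0_ler_powR (ltW p_gt0)); rewrite !nnegrE powR_ge0 ler0n => /(_ isT isT).
  rewrite -powRrM mulVf ?gt_eqF// powRr1// ler_pdivlMr// => h.
  by rewrite ler_pdivlMr//; apply: le_trans h; rewrite le_eqVlt; apply/orP; left; apply/eqP; ring.
apply: (@le_trans _ _ (expR (L / 2) * (a * expR (- (L / 4))))).
  rewrite mulrCA -expRD (_ : L / 2 - L / 4 = L / 4); last by field.
  apply: (@le_trans _ _ (a * (L / 4))); first by lra.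
  by rewrite ler_wpM2l ?(ltW a0)//; have := expR_ge1Dx (L / 4); lra.
apply: ler_pM; [exact: expR_ge0| |exact: Leta|].
  by rewrite mulr_ge0 ?(ltW a0) ?expR_ge0.
apply: le_trans (hmu i); rewrite ler_wpM2l ?(ltW a0)// ler_expR.
by rewrite lerN2.
Qed.

End DecayRates.

(** * The stopping time *)

Section StoppingTime.
Context {R : realType} {n : nat}.
Variables (step : nat -> R) (lam : 'rV[R]_n).
Hypothesis cond : step_conditions step lam.
Hypothesis n_gt0 : (0 < n)%N.

Let nR_gt0 : 0 < n%:R :> R. Proof. by rewrite ltr0n. Qed.

Lemma stop_criterionE t : 0 < total_step step t ->
  stop_criterion step lam t <->
  n%:R < total_step step t * Num.sqrt (eff_dim (lam 0) (total_step step t)).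
Proof.
move=> e0; rewrite /stop_criterion -/(eff_dim (lam 0) (total_step step t)).
set e := total_step step t in e0 *; set s := Num.sqrt _.
have -> : (e^-1 < n%:R^-1 * s) = (n%:R < e * s).
  by rewrite mulrC ltr_pdivlMr// mulrC ltr_pdivrMr// mulrC.
by split => [[]|].
Qed.

(** Along the iterations the total step size grows to infinity by increments
    of at most one, so it crosses the threshold of the criterion with an
    overshoot of at most one. *)
Lemma stopping_time_between (lo hi : R) : 0 < hi ->
  (forall t, hi <= total_step step t -> stop_criterion step lam t) ->
  (forall t, 0 < total_step step t <= lo -> ~ stop_criterion step lam t) ->
  exists T, stopping_time step lam T /\ lo <= total_step step T <= hi + 1.
Proof.
move=> hi0 stop nostop.
have /cvgryPge/(_ hi)[t0 _ /(_ t0 (leqnn t0))/= ht0] := total_step_infty cond.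
have exT : exists t, `[< stop_criterion step lam t >].
  by exists t0; apply/asboolP; exact: stop.
case: (ex_minnP exT) => T /asboolP crit minT.
exists T; split; first split=> // t tT /asboolP /minT.
  by rewrite leqNgt tT.
have [T0 _] := crit; apply/andP; split.
  rewrite leNgt; apply/negP => Tlo.
  by apply: (nostop T) => //; rewrite T0 ltW.
case: T crit minT T0 => [|T] crit minT T0.
  by move: T0; rewrite /total_step big_ord0 ltxx.
rewrite total_stepS lerD ?(step_le1 cond)// leNgt; apply/negP => hiT.
by have /asboolP/minT := stop T (ltW hiT); rewrite ltnn.
Qed.

End StoppingTime.

Lemma ln_nat_large {R : realType} (M : R) :
  exists N : nat, forall n, (N <= n)%N ->
  [/\ (0 < n)%N, M <= ln (n%:R : R) & n%:R = expR (ln (n%:R : R))].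
Proof.
exists (Num.trunc (expR M)).+1 => n Nn.
have nM : expR M <= n%:R.
  by rewrite ltW// (lt_le_trans (truncnS_gt _))// ler_nat.
have n0 : 0 < n%:R :> R by apply: lt_le_trans nM; exact: expR_gt0.
have nE : n%:R = expR (ln (n%:R : R)) by rewrite lnK.
by split; [rewrite -(ltr0n R)|rewrite -ler_expR -nE|].
Qed.

(** * The order of the stopped total step size *)

Section NoiseMoments.
Context {R : realType} {dO : measure_display} {O : measurableType dO}
  (P : probability O R) (eps : nat -> {RV P >-> R}).
Hypothesis heps : iid_with_law eps (normal_prob 0 1).

Definition normal_kurtosis : R := \int[@normal_prob R 0 1]_x ((x ^+ 2 - 1) ^+ 2).

(* [normal_prob] is a measure on a copy of the reals with another display; the
   identity between the two copies is used as a random variable. *)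
Let mid : @measurable_fun _ _ (measurableTypeR R) R setT id.
Proof. by []. Qed.

Let normal_id : {RV @normal_prob R 0 1 >-> R} :=
  @mfun_Sub _ _ (measurableTypeR R) R id (mem_set mid).

Let law i A : measurable A ->
  distribution P (eps i) A = distribution (@normal_prob R 0 1) normal_id A.
Proof. exact: heps.1. Qed.

Let normal_L4 : sqint (@normal_prob R 0 1) (fun x => x ^+ 2 - 1).
Proof. by apply: sqintD; [exact: sqint_normal_sqr|exact: sqint_cst]. Qed.

Let msqr : measurable_fun setT (fun x : R => x ^+ 2).
Proof. exact: measurable_funX. Qed.

Let mdev : measurable_fun setT (fun x : R => (x ^+ 2 - 1) ^+ 2).
Proof. by apply: measurable_funX; exact: measurable_funB. Qed.

Lemma noise_L2 i : sqint P (eps i).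
Proof.
by split => //; exact: (summable_eq_law (@law i) msqr sqint_normal.2).
Qed.

Lemma noise_L4 i : sqint P (fun w => eps i w ^+ 2 - 1).
Proof.
split; last exact: (summable_eq_law (@law i) mdev normal_L4.2).
by apply: measurable_funB => //; exact: measurable_funX.
Qed.

Lemma noise_mean i : \int[P]_w eps i w = 0.
Proof.
by rewrite (mean_eq_law (@law i) (g := id) _ (sqint_summable sqint_normal))// normal_mean.
Qed.

Lemma noise_variance i : \int[P]_w (eps i w ^+ 2) = 1.
Proof.
by rewrite (mean_eq_law (@law i) msqr sqint_normal.2) normal_variance.
Qed.

Lemma noise_kurtosis i : \int[P]_w ((eps i w ^+ 2 - 1) ^+ 2) <= normal_kurtosis.
Proof. by rewrite (mean_eq_law (@law i) mdev normal_L4.2). Qed.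

Lemma normal_kurtosis_ge0 : 0 <= normal_kurtosis.
Proof. by apply: mean_ge0 => x; exact: sqr_ge0. Qed.

End NoiseMoments.

Section Rates.
Context {R : realType} {n : nat}.
Variables (step : nat -> R) (lam : 'rV[R]_n).
Hypothesis cond : step_conditions step lam.
Variables (A c L q : R).
Hypotheses (nL : n%:R = expR L) (q_ge1 : 1 <= q).
Hypotheses (A_ge1 : 1 <= A).
Hypothesis upper : forall eta, 0 <= eta <= n%:R ->
  eff_dim (lam 0) eta <= A * q ^+ 2.

Let nR_gt0 : 0 < n%:R :> R. Proof. by rewrite nL expR_gt0. Qed.
Let n_gt0 : (0 < n)%N. Proof. by rewrite -(ltr0n R). Qed.
Let q_gt0 : 0 < q. Proof. exact: lt_le_trans q_ge1. Qed.
Let A_gt0 : 0 < A. Proof. exact: lt_le_trans A_ge1. Qed.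

(** The criterion compares [n] with [eta * sqrt (eff_dim eta)], and the
    effective dimension is of order [q ^+ 2] at every scale between [n^(1/2)]
    and [n]; hence it is first met at [eta] of order [n / q]. *)
Lemma stopping_time_rate : q <= L -> 0 < c -> 4 * Num.sqrt c <= L ->
  (forall eta, expR (L / 2) <= eta -> c * q ^+ 2 <= eff_dim (lam 0) eta) ->
  exists T, stopping_time step lam T /\
    (Num.sqrt A)^-1 * (n%:R * q^-1) <= total_step step T <=
    (2 / Num.sqrt c + 1) * (n%:R * q^-1).
Proof.
move=> qL c0 cL lower.
have sA : 1 <= Num.sqrt A by rewrite -[leLHS]sqrtr1 ler_wsqrtr.
have sA0 : 0 < Num.sqrt A by exact: lt_le_trans sA.
have sc0 : 0 < Num.sqrt c by rewrite sqrtr_gt0.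
have nq1 : 1 <= n%:R * q^-1.
  rewrite ler_pdivlMr// mul1r nL (le_trans qL)//.
  by have := expR_ge1Dx L; lra.
have hi_ge : expR (L / 2) <= 2 / Num.sqrt c * (n%:R * q^-1).
  have L0 : 0 < L by exact: lt_le_trans qL.
  have e2 : n%:R = expR (L / 2) * expR (L / 2).
    by rewrite nL -expRD; congr expR; field.
  have eL : L ^+ 2 / 8 <= expR (L / 2).
    have /(_ (L / 2) 1) := @expR_ge1Dxn R; rewrite divr_ge0 ?(ltW L0)// => /(_ isT) h.
    have {h} : 1 + (L / 2) ^+ 2 / 2 <= expR (L / 2) by exact: h.
    by rewrite (_ : (L / 2) ^+ 2 / 2 = L ^+ 2 / 8); [lra|field].
  rewrite e2 [leRHS](_ : _ = expR (L / 2) * (2 * expR (L / 2) / (Num.sqrt c * q))); last first.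
    by field; rewrite !gt_eqF.
  rewrite ler_peMr ?expR_ge0// ler_pdivlMr ?mulr_gt0// mul1r.
  apply: (@le_trans _ _ (L ^+ 2 / 4)); last by lra.
  rewrite (_ : L ^+ 2 / 4 = (L / 4) * L); last by field.
  by rewrite ler_pM ?(ltW sc0) ?(ltW q_gt0)// ler_pdivlMr// mulrC.
have [] := @stopping_time_between _ _ _ _ cond
  ((Num.sqrt A)^-1 * (n%:R * q^-1)) (2 / Num.sqrt c * (n%:R * q^-1)).
- by rewrite mulr_gt0// ?divr_gt0//.
- move=> t ht; have e0 : 0 < total_step step t.
    by apply: lt_le_trans ht; rewrite mulr_gt0// divr_gt0.
  apply/(stop_criterionE lam n_gt0 e0).
  have := lower _ (le_trans hi_ge ht) => le_eff.
  apply: (@lt_le_trans _ _ (2 / Num.sqrt c * (n%:R * q^-1) * (Num.sqrt c * q))).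
    rewrite [ltRHS](_ : _ = 2 * n%:R); last by field; rewrite !gt_eqF.
    by rewrite ltr_pMl// ltr1n.
  apply: ler_pM => //.
  + by rewrite !mulr_ge0 ?invr_ge0 ?(ltW sc0) ?(ltW q_gt0) ?(ltW nR_gt0).
  + by rewrite mulr_ge0 ?(ltW sc0) ?(ltW q_gt0).
  + rewrite -[q in X in X <= _](ger0_norm (ltW q_gt0)) -sqrtr_sqr -sqrtrM ?(ltW c0)//.
    by rewrite ler_wsqrtr.
- move=> t /andP[e0 et] /(stop_criterionE lam n_gt0 e0); apply/negP; rewrite -leNgt.
  have etn : total_step step t <= n%:R.
    apply: (le_trans et); rewrite mulrCA ler_piMr ?(ltW nR_gt0)//.
    by rewrite mulr_ile1 ?invr_ge0 ?(ltW sA0) ?(ltW q_gt0)// invf_le1.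
  apply: (@le_trans _ _ ((Num.sqrt A)^-1 * (n%:R * q^-1) * (Num.sqrt A * q))); last first.
    by rewrite le_eqVlt; apply/orP; left; apply/eqP; field; rewrite !gt_eqF.
  apply: ler_pM => //; first exact: ltW.
  rewrite -[q in X in _ <= X](ger0_norm (ltW q_gt0)) -sqrtr_sqr -sqrtrM ?(ltW A_gt0)//.
  by rewrite ler_wsqrtr// upper// (ltW e0).
move=> T [stopT /andP[lo hi]]; exists T; split => //; rewrite lo /=.
by apply: (le_trans hi); move: nq1; set X := n%:R * _; lra.
Qed.

End Rates.

(** * Power at the stopping time *)

Section SeparatedPower.
Context {R : realType} {dO : measure_display} {O : measurableType dO}
  (P : probability O R) (eps : nat -> {RV P >-> R}).
Hypothesis heps : iid_with_law eps (normal_prob 0 1).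
Context {d : nat} {XX : set (d.-tuple R)} {PX : probability (d.-tuple R) R}
  {H : completeNormedModType R} {ip : {dot H for idfun}}
  {ev : H -> d.-tuple R -> R} {K : d.-tuple R -> d.-tuple R -> R}.
Hypothesis hH : is_rkhs XX PX ip ev K.
Context {n : nat}.
Variables (xs : n.-tuple (d.-tuple R)) (U : 'M[R]_n) (lam : 'rV[R]_n).
Variable (step : nat -> R).
Hypothesis n_gt0 : (0 < n)%N.
Hypothesis xsX : forall i, XX (tnth xs i).
Hypothesis spec : spectral_decomposition (emp_kernel K xs) U lam.
Hypothesis cond : step_conditions step lam.

Let nR_gt0 : 0 < n%:R :> R. Proof. by rewrite ltr0n. Qed.

Let lam_ge0 l : 0 <= lam 0 l.
Proof. by have [_ _ _] := spec; exact. Qed.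

Let step_lam t l : step t * lam 0 l <= 1.
Proof.
have [_ _ mono _] := spec.
have := step_le_inv cond t (i := Ordinal n_gt0) erefl.
by apply: le_trans; rewrite ler_wpM2l ?(step_ge0 cond)// mono.
Qed.

Lemma signal_ge (f : H) (C : R) (t : nat) : `|f| <= C ->
  0 < total_step step t ->
  n%:R * emp_norm xs (ev f) ^+ 2 / 2 - C ^+ 2 * n%:R / total_step step t <=
  \sum_l ((1 - shrink step lam t l) * eval_coord xs U (ev f) l) ^+ 2.
Proof.
move=> fC e0.
have bias : \sum_l shrink step lam t l ^+ 2 * eval_coord xs U (ev f) l ^+ 2 <=
    C ^+ 2 * n%:R / total_step step t.
  apply: (bias_le spec n_gt0 e0 lam_ge0).
    move=> w; apply: (le_trans (rkhs_sample_bound hH f w xsX)).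
    rewrite ler_wpM2r//; last by rewrite ler_sqr ?nnegrE// (le_trans _ fC).
    rewrite (kernel_form spec n_gt0) mulr_ge0//.
    by apply: sumr_ge0 => l _; rewrite mulr_ge0// sqr_ge0.
  move=> l; apply: shrink_bias => //; exact: step_ge0 cond.
have energy : n%:R * emp_norm xs (ev f) ^+ 2 = \sum_l eval_coord xs U (ev f) l ^+ 2.
  rewrite /emp_norm sqr_sqrtr; last first.
    by rewrite mulr_ge0 ?invr_ge0//; apply: sumr_ge0 => i _; exact: sqr_ge0.
  rewrite mulrA mulfV ?gt_eqF// mul1r.
  under [RHS]eq_bigr do rewrite expr2.
  by rewrite (eigen_coord_dot spec); apply: eq_bigr => i _; rewrite expr2.
rewrite energy; apply: le_trans (lerB (lexx _) bias) _.
rewrite mulr_suml -sumrB; apply: ler_sum => l _.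
set s := shrink _ _ _ _; set v := eval_coord _ _ _ _.
(* From [v = (1 - s) * v + s * v] and [(x + y) ^+ 2 <= 2 * x ^+ 2 + 2 * y ^+ 2]. *)
have -> : ((1 - s) * v) ^+ 2 = v ^+ 2 / 2 - s ^+ 2 * v ^+ 2 + (v - 2 * s * v) ^+ 2 / 2 by field.
by rewrite lerDl divr_ge0// sqr_ge0.
Qed.

(** The test has power at least [1 - e] as soon as the separation constant
    [kappa] dominates the bias of the early stopped estimator, the quantile of
    the null distribution and the variance of the noise. *)
Lemma separation_power (T : nat) (A q C alpha e kappa : R) (f : H) :
  1 <= q -> 0 < A -> 0 < e ->
  (Num.sqrt A)^-1 * (n%:R * q^-1) <= total_step step T ->
  eff_dim (lam 0) (total_step step T) <= A * q ^+ 2 ->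
  `|f| <= C ->
  2 * (kappa + C ^+ 2 * Num.sqrt A) * q <= n%:R * emp_norm xs (ev f) ^+ 2 ->
  1 <= kappa ->
  2 * `|normal_quantile (1 - alpha / 2)| * Num.sqrt (2 * A) <= kappa ->
  (64 + (64 + 8 * normal_kurtosis) * A) / e <= kappa ->
  ((1 - e)%:E <= cond_prob eps xs (ev f)
     [set y | reject alpha (emp_kernel K xs) lam step y T])%E.
Proof.
move=> q1 A0 e0 eta_ge eff fC sep k1 kz ke.
have q0 : 0 < q by exact: lt_le_trans q1.
have k0 : 0 < kappa by exact: lt_le_trans k1.
have sA0 : 0 < Num.sqrt A by rewrite sqrtr_gt0.
have M0 : 0 <= @normal_kurtosis R by exact: normal_kurtosis_ge0.
set eta := total_step step T in eta_ge eff.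
have eta0 : 0 < eta.
  by apply: lt_le_trans eta_ge; rewrite mulr_gt0 ?invr_gt0// divr_gt0.
pose W := kappa * q.
have W0 : 0 < W by rewrite mulr_gt0.
pose N := A * q ^+ 2.
have signalW : W <= \sum_l ((1 - shrink step lam T l) * eval_coord xs U (ev f) l) ^+ 2.
  apply: le_trans (signal_ge fC eta0).
  have : C ^+ 2 * n%:R / eta <= C ^+ 2 * Num.sqrt A * q.
    have h : n%:R / eta <= Num.sqrt A * q.
      rewrite ler_pdivrMr// -ler_pdivrMl ?mulr_gt0//; apply: le_trans eta_ge.
      by rewrite le_eqVlt; apply/orP; left; apply/eqP; field; rewrite !gt_eqF.
    by have := ler_wpM2l (sqr_ge0 C) h; rewrite !mulrA.
  by rewrite /W; move: sep; set x := n%:R * _; lra.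
have a01 l : 0 <= 1 - shrink step lam T l <= 1.
  have s0 := shrink_ge0 step_lam T l.
  have s1 := shrink_le1 lam_ge0 (step_ge0 cond) step_lam T l.
  by apply/andP; split; lra.
have aN : \sum_l (1 - shrink step lam T l) ^+ 4 <= N.
  apply: le_trans eff; apply: ler_sum => l _.
  have /andP[a0 a1] := a01 l.
  apply: (@le_trans _ _ (1 - shrink step lam T l)).
    by rewrite -[leRHS]expr1 ler_wiXn2l.
  rewrite le_min a1 /=.
  exact: (shrink_bernoulli lam_ge0 (step_ge0 cond) step_lam).
have zN : `|normal_quantile (1 - alpha / 2)| * Num.sqrt (2 * N) <= W / 2.
  rewrite /N mulrA sqrtrM ?mulr_ge0 ?(ltW A0)// sqrtr_sqr (ger0_norm (ltW q0)).
  rewrite mulrA /W [leRHS]mulrAC ler_pM2r//.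
  by move: kz; set z := Num.sqrt _; lra.
apply: le_trans (reject_power heps.2 (noise_L2 heps) (noise_L4 heps)
  (noise_mean heps) (noise_variance heps) (noise_kurtosis heps) spec a01 n_gt0 W0
  signalW aN zN).
rewrite lee_fin lerD2l lerN2.
apply: le_trans (_ : (64 + (64 + 8 * normal_kurtosis) * A) / kappa <= _); last first.
  by rewrite ler_pdivrMr// [leRHS]mulrC -ler_pdivrMr.
rewrite (_ : _ * N / W ^+ 2 = (64 + 8 * normal_kurtosis) * A / kappa ^+ 2); last first.
  by rewrite /N /W; field; rewrite !gt_eqF.
rewrite [leRHS]mulrDl; apply: lerD.
  rewrite ler_pM2l// lef_pV2 ?posrE// /W ler_peMr// ltW//.
have c0 : 0 <= (64 + 8 * normal_kurtosis) * A.
  by apply: mulr_ge0; [lra|exact: ltW].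
by rewrite ler_wpM2l// lef_pV2 ?posrE ?exprn_gt0// expr2 ler_peMr// ltW.
Qed.

End SeparatedPower.

(** * The corollary *)

Section KernelRates.
Context {R : realType} {d : nat} {XX : set (d.-tuple R)}
  {PX : probability (d.-tuple R) R} {H : completeNormedModType R}
  {ip : {dot H for idfun}} {ev : H -> d.-tuple R -> R}
  {K : d.-tuple R -> d.-tuple R -> R} {mu : nat -> R} {phi : nat -> H}.
Hypothesis hXX : measurable XX.
Hypothesis hH : is_rkhs XX PX ip ev K.
Hypothesis hK : mercer_expansion XX PX ip ev K mu phi.
Variable cK : R.
Hypothesis cK_gt0 : 0 < cK.
Hypothesis hphi : forall j x, XX x -> `|ev (phi j) x| <= cK.

(** The eigenfunctions are only known to be measurable and bounded on [XX];
    outside they are replaced by zero. *)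
Definition eigenfun (i : nat) : d.-tuple R -> R := ev (phi i) \_ XX.

Let eigenfunE i x : XX x -> eigenfun i x = ev (phi i) x.
Proof. by move=> Xx; rewrite /eigenfun patchE mem_set. Qed.

Lemma measurable_eigenfun i : measurable_fun setT (eigenfun i).
Proof.
apply/(measurable_restrictT _ hXX).
by have [] := rkhs_L2 hH (phi i).
Qed.

Lemma eigenfun_bound i x : `|eigenfun i x| <= cK.
Proof.
rewrite /eigenfun patchE; case: ifPn => [/set_mem/hphi//|_].
by rewrite normr0 ltW.
Qed.

Lemma eigenfun_ortho i j :
  \int[PX]_x (eigenfun i x * eigenfun j x) = (i == j)%:R.
Proof.
have := mercer_ortho_L2 hK i j; rewrite integral_mkcond => /(congr1 fine) /= <-.
rewrite /Rintegral; congr fine; apply: eq_integral => x _.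
by rewrite /eigenfun !patchE; case: ifP => //; rewrite mulr0.
Qed.

Context {n : nat}.
Variables (xs : n.-tuple (d.-tuple R)) (U : 'M[R]_n) (lam : 'rV[R]_n).
Hypothesis n_gt0 : (0 < n)%N.
Hypothesis xsX : forall i, XX (tnth xs i).
Hypothesis spec : spectral_decomposition (emp_kernel K xs) U lam.
Variables (beta p : R).
Hypotheses (beta_gt0 : 0 < beta) (p_ge1 : 1 <= p).

Let lam_ge0 l : 0 <= lam 0 l.
Proof. by have [_ _ _] := spec; exact. Qed.

Let mercer i j : series (fun m =>
  mu m * eigenfun m (tnth xs i) * eigenfun m (tnth xs j)) @ \oo -->
  K (tnth xs i) (tnth xs j).
Proof.
have := mercer_sum hK (xsX i) (xsX j).
rewrite (_ : (fun m => mu m * eigenfun m _ * _) =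
  (fun m => mu m * ev (phi m) (tnth xs i) * ev (phi m) (tnth xs j)))//.
by apply/funext => m; rewrite !eigenfunE.
Qed.

Let v i l := eval_coord xs U (eigenfun i) l.

Let mercer_le k (c : 'I_n -> R) :
  \sum_(i < k) mu i * (\sum_l v i l * c l) ^+ 2 <=
  n%:R * \sum_l lam 0 l * c l ^+ 2.
Proof. exact: (mercer_truncation_le spec n_gt0 (mercer_ge0 hK) mercer). Qed.

Lemma kernel_eff_dim_upper (b L eta : R) : 0 <= b ->
  (forall i, mu i <= b * expR (- (beta * i.+1%:R `^ p))) ->
  1 <= L -> n%:R = expR L -> 0 <= eta <= n%:R ->
  eff_dim (lam 0) eta <= eff_dim_const beta p b cK * L `^ p^-1.
Proof.
move=> b0 hb L1 nL eta0n; have /andP[eta0 _] := eta0n.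
apply: le_trans (upper_cutoff_rate beta_gt0 p_ge1 cK b0 L1 nL eta0n).
apply: (eff_dim_upper lam_ge0 (mercer_ge0 hK) mercer_le eta0 _ n_gt0).
apply: (mercer_trace_le spec n_gt0 (mercer_ge0 hK) mercer).
  by move=> m j; exact: eigenfun_bound.
by move=> N; exact: decay_tail.
Qed.

Lemma kernel_eff_dim_lower (a L eta : R) : 0 < a ->
  (forall i, a * expR (- (beta * i.+1%:R `^ p)) <= mu i) ->
  1 <= L -> 4 * beta <= L -> 16 <= a * L -> expR (L / 2) <= eta ->
  gram_event eigenfun n (lower_cutoff beta p L) xs ->
  lower_const beta p / 12 * L `^ p^-1 <= eff_dim (lam 0) eta.
Proof.
move=> a0 ha L1 bL aL Leta gram.
have eta0 : 0 <= eta by apply: le_trans Leta; exact: expR_ge0.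
apply: (@le_trans _ _ ((lower_cutoff beta p L)%:R / 6)).
  have := lower_cutoff_ge beta_gt0 p_ge1 bL.
  by set k := (lower_cutoff _ _ _)%:R; set s := L `^ _; lra.
apply: (eff_dim_lower lam_ge0 (mercer_ge0 hK) mercer_le eta0 n_gt0).
  apply: le_trans gram; rewrite le_eqVlt; apply/orP; left; apply/eqP.
  apply: eq_bigr => i _; apply: eq_bigr => j _; congr (_ ^+ 2).
  by rewrite /gram_dev /v /eval_coord (eigen_coord_dot spec).
apply: (lower_cutoff_eigen beta_gt0 p_ge1 a0 ha _ aL Leta).
by lra.
Qed.

End KernelRates.

(** With [n = exp L], a polynomial in [ln n] over [n] is below [n^(-1/2)]; the
    constant 192 comes from [L ^+ 3 / 48 <= exp (L / 2)]. *)
Lemma gram_failure_rate {R : realType} (B k lc L : R) : 0 <= k -> k <= lc * L -> 1 <= L ->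
  192 * lc ^+ 2 * (B ^+ 2 + 1) ^+ 2 <= L ->
  4 * k ^+ 2 * (B ^+ 2 + 1) ^+ 2 / expR L <= expR (- (L / 2)).
Proof.
move=> k0 kL L1 hL; have L0 : 0 <= L by lra.
rewrite ler_pdivrMr ?expR_gt0// -expRD (_ : - (L / 2) + L = L / 2); last by field.
have L3 : L ^+ 3 / 48 <= expR (L / 2).
  have /(_ (L / 2) 2) := @expR_ge1Dxn R; rewrite divr_ge0// => /(_ isT) h.
  have {h} : 1 + (L / 2) ^+ 3 / 6 <= expR (L / 2) by exact: h.
  by rewrite (_ : (L / 2) ^+ 3 / 6 = L ^+ 3 / 48); [lra|field].
apply: le_trans L3.
have k2 : k ^+ 2 <= lc ^+ 2 * L ^+ 2.
  by rewrite -exprMn ler_sqr ?nnegrE// (le_trans k0).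
set v := (B ^+ 2 + 1) ^+ 2 in hL *.
have v0 : 0 <= v by exact: sqr_ge0.
apply: (@le_trans _ _ (4 * (lc ^+ 2 * L ^+ 2) * v)).
  by rewrite ler_wpM2r// ler_pM2l.
rewrite (_ : 4 * _ * v = (192 * lc ^+ 2 * v) * (L ^+ 2 / 48)); last by field.
rewrite (_ : L ^+ 3 / 48 = L * (L ^+ 2 / 48)); last by field.
by rewrite ler_wpM2r// divr_ge0// sqr_ge0.
Qed.

Theorem corollary3p5 (R : realType) (beta p : R) (hbeta : 0 < beta)
    (hp : 1 <= p) :
  exists c_betap c1 : R, [/\ 0 < c_betap, 0 < c1 &
  forall
    (* covariate space and distribution *)
    (d : nat) (hd : (0 < d)%N) (XX : set (d.-tuple R)) (hXX : measurable XX)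
    (PX : probability (d.-tuple R) R)
    (* kernel and its Mercer expansion *)
    (H : completeNormedModType R) (ip : {dot H for idfun})
    (ev : H -> d.-tuple R -> R) (K : d.-tuple R -> d.-tuple R -> R)
    (hH : is_rkhs XX PX ip ev K)
    (mu : nat -> R) (phi : nat -> H)
    (hK : mercer_expansion XX PX ip ev K mu phi)
    (hmu : exponential_polynomial_decay mu beta p)
    (cK : R) (hcK : 0 < cK)
    (hphi : forall j x, XX x -> `|ev (phi j) x| <= cK)
    (* covariates and noise *)
    (dO : measure_display) (O : measurableType dO) (P : probability O R)
    (x : nat -> {RV P >-> d.-tuple R}) (hxX : forall i w, XX (x i w))
    (hx : iid_with_law x PX)
    (eps : nat -> {RV P >-> R}) (heps : iid_with_law eps (normal_prob 0 1))
    (hxeps : independent_sequences x eps)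
    (* spectral decomposition of the empirical kernel matrix *)
    (U : forall n : nat, n.-tuple (d.-tuple R) -> 'M[R]_n)
    (muhat : forall n : nat, n.-tuple (d.-tuple R) -> 'rV[R]_n)
    (hspec : forall (n : nat) (xs : n.-tuple (d.-tuple R)), (0 < n)%N ->
      (forall i, XX (tnth xs i)) ->
      spectral_decomposition (emp_kernel K xs) (U n xs) (muhat n xs))
    (* step sizes, possibly depending on the covariates *)
    (step : forall n : nat, n.-tuple (d.-tuple R) -> nat -> R)
    (hstep : forall (n : nat) (xs : n.-tuple (d.-tuple R)), (0 < n)%N ->
      (forall i, XX (tnth xs i)) ->
      step_conditions (step n xs) (muhat n xs))
    (* radius of the ball and significance level *)
    (C : R) (alpha : R) (halpha : 0 < alpha < 1),
  exists a b : R, [/\ 0 < a, 0 < b &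
  forall e : R, 0 < e -> exists (C_e : R) (N_e : nat), 0 < C_e /\
  forall n : nat, (N_e <= n)%N ->
  exists G : set (n.-tuple (d.-tuple R)),
  [/\ measurable G,
      ((1 - expR (- (c_betap * n%:R * ln n%:R `^ (- (2 / p))))
          - expR (- (c1 * ln n%:R `^ p^-1)))%:E < P (sample x n @^-1` G))%E &
      forall xs : n.-tuple (d.-tuple R), G xs -> (forall i, XX (tnth xs i)) ->
      exists T : nat,
      [/\ stopping_time (step n xs) (muhat n xs) T,
          a * (n%:R * ln n%:R `^ (- (2 * p)^-1)) <= total_step (step n xs) T
            <= b * (n%:R * ln n%:R `^ (- (2 * p)^-1)) &
          ((1 - e)%:E <= ereal_inf
            [set cond_prob eps xs (ev f)
               [set y | reject alpha (emp_kernel K xs) (muhat n xs)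
                          (step n xs) y T]
            | f in separated_ball ev C xs
                (C_e * n%:R `^ (- 2^-1) * ln n%:R `^ (4 * p)^-1)])%E]]]].
Proof.
have p_gt0 : 0 < p by exact: lt_le_trans hp.
exists 1, (2^-1); split=> //.
move=> d hd XX hXX PX H ip ev K hH mu phi hK [am [bm [am0 bm0 hmu]]] cK hcK hphi
  dO O P x hxX hx eps heps hxeps U muhat hspec step hstep C alpha halpha.
have mu_lb i : am * expR (- (beta * i.+1%:R `^ p)) <= mu i by have /andP[] := hmu i.
have mu_ub i : mu i <= bm * expR (- (beta * i.+1%:R `^ p)) by have /andP[] := hmu i.
pose A := eff_dim_const beta p bm cK.
pose c := lower_const beta p / 12.
have c0 : 0 < c by rewrite divr_gt0// lower_const_gt0.
have eb1 : 0 < 1 - expR (- beta).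
  by rewrite subr_gt0 -[ltRHS]expR0 ltr_expR oppr_lt0.
have A1 : 1 <= A.
  have u0 : 0 <= beta^-1 `^ p^-1 by exact: powR_ge0.
  have w0 : 0 <= cK ^+ 2 * bm / (1 - expR (- beta)).
    apply: divr_ge0; last exact: ltW.
    by apply: mulr_ge0; [exact: sqr_ge0|exact: ltW].
  by rewrite /A /eff_dim_const; move: u0 w0; clear; lra.
have A0 : 0 < A by exact: lt_le_trans A1.
have sA0 : 0 < Num.sqrt A by rewrite sqrtr_gt0.
have sc0 : 0 < Num.sqrt c by rewrite sqrtr_gt0.
pose a := (Num.sqrt A)^-1; pose b := 2 / Num.sqrt c + 1.
have b0 : 0 < b by rewrite ltr_wpDl// divr_ge0// ltW.
exists a, b; split => //; first by rewrite invr_gt0.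
move=> e e0.
pose z := normal_quantile (1 - alpha / 2) : R.
(* One summand for each of the last three hypotheses of [separation_power]. *)
pose kappa := 1 + 2 * `|z| * Num.sqrt (2 * A) +
  (64 + (64 + 8 * normal_kurtosis) * A) / e.
have kz0 : 0 <= 2 * `|z| * Num.sqrt (2 * A) by rewrite !mulr_ge0 ?sqrtr_ge0.
have M0 : 0 <= @normal_kurtosis R by exact: normal_kurtosis_ge0.
have ke0 : 0 <= (64 + (64 + 8 * normal_kurtosis) * A) / e.
  apply: divr_ge0; last exact: ltW.
  apply: addr_ge0 => //; apply: mulr_ge0; last exact: ltW.
  by rewrite addr_ge0// mulr_ge0.
have kappa1 : 1 <= kappa by rewrite /kappa -addrA lerDl addr_ge0.
have sep0 : 0 < 2 * (kappa + C ^+ 2 * Num.sqrt A).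
  rewrite mulr_gt0// ltr_pwDl//; first by exact: lt_le_trans kappa1.
  by apply: mulr_ge0; [exact: sqr_ge0|exact: ltW].
(* Each summand is one of the lower bounds on [ln n] that the proof needs. *)
pose Lmin := 1 + 4 * Num.sqrt c + 4 * beta + 16 / am + b `^ (2 * p) +
  192 * lower_const beta p ^+ 2 * (cK ^+ 2 + 1) ^+ 2.
have [Ne largeN] := ln_nat_large Lmin.
exists (Num.sqrt (2 * (kappa + C ^+ 2 * Num.sqrt A))), Ne.
split; first by rewrite sqrtr_gt0.
move=> n /largeN[n_gt0 LM nL]; set L := ln _ in LM nL *.
have [L1 [Lc [Lb [La [Lbp Lv]]]]] : 1 <= L /\ 4 * Num.sqrt c <= L /\ 4 * beta <= L /\
    16 / am <= L /\ b `^ (2 * p) <= L /\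
    192 * lower_const beta p ^+ 2 * (cK ^+ 2 + 1) ^+ 2 <= L.
  have h1 : 0 <= 16 / am by rewrite divr_ge0// ltW.
  have h2 : 0 <= b `^ (2 * p) by exact: powR_ge0.
  have h3 : 0 <= 192 * lower_const beta p ^+ 2 * (cK ^+ 2 + 1) ^+ 2.
    by apply: mulr_ge0; [apply: mulr_ge0 => //; exact: sqr_ge0|exact: sqr_ge0].
  move: LM; rewrite /Lmin; move: h1 h2 h3 (ltW sc0) (ltW hbeta).
  set t1 := 16 / am; set t2 := b `^ _; set t3 := 192 * _ * _.
  clear; move=> *; do !split; lra.
have L0 : 0 < L by exact: lt_le_trans L1.
(* All the rates are powers of [q], whose square is [(ln n)^(1/p)]. *)
pose q := L `^ (2 * p)^-1.
have p2 : 0 < 2 * p by rewrite mulr_gt0.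
have q0 : 0 < q by rewrite powR_gt0.
have q1 : 1 <= q by rewrite -[leLHS](powRr0 L) ler_powR// invr_ge0 ltW.
have qL : q <= L.
  rewrite ler1_powR// invf_le1// -[leLHS]mul1r ler_pM//.
  by rewrite ler1n.
have q2 : L `^ p^-1 = q ^+ 2.
  rewrite -powR_mulrn ?(ltW q0)// -powRrM; congr (_ `^ _); field.
  by rewrite gt_eqF.
have qV : L `^ (- (2 * p)^-1) = q^-1 by rewrite powRN.
have qsqrt : (L `^ (4 * p)^-1) ^+ 2 = q.
  rewrite -powR_mulrn ?powR_ge0// -powRrM; congr (_ `^ _); field.
  by rewrite gt_eqF.
have bq : b <= q.
  have -> : b = (b `^ (2 * p)) `^ (2 * p)^-1.
    by rewrite -powRrM mulfV ?gt_eqF// powRr1// ltW.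
  by rewrite ge0_ler_powR ?nnegrE ?powR_ge0 ?invr_ge0 ?(ltW p2) ?(ltW L0).
have aL : 16 <= am * L by rewrite mulrC -ler_pdivrMr.
have nR0 : 0 < n%:R :> R by rewrite ltr0n.
pose psi := @eigenfun _ _ XX _ ev phi.
exists (gram_event psi n (lower_cutoff beta p L)); split.
- by apply: measurable_gram_event => i; exact: (measurable_eigenfun hXX hH).
- have := prob_gram_event hx (measurable_eigenfun hXX hH)
    (eigenfun_bound hcK hphi) (eigenfun_ortho hK) (lower_cutoff beta p L) n_gt0.
  apply: lt_le_trans; rewrite lte_fin.
  have := gram_failure_rate (B := cK) (ler0n R _) (lower_cutoff_le hbeta hp L1) L1 Lv.
  rewrite -nL.
  set pr := 4 * _ * _ / _ => fail.
  have : expR (- (L / 2)) <= expR (- (2^-1 * L `^ p^-1)).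
    rewrite ler_expR lerN2 mulrC ler_pM2r// ?invr_gt0//.
    by rewrite ler1_powR// invf_le1.
  have := expR_gt0 (- (1 * n%:R * L `^ (- (2 / p)))).
  by move: fail; clear; lra.
move=> xs Gxs xsX.
have spec := hspec n xs n_gt0 xsX; have cond := hstep n xs n_gt0 xsX.
have upper eta : 0 <= eta <= n%:R -> eff_dim (muhat n xs 0) eta <= A * q ^+ 2.
  move=> eta0; rewrite -q2.
  exact: (kernel_eff_dim_upper hK hcK hphi n_gt0 xsX spec hbeta hp (ltW bm0) mu_ub L1 nL).
have lower eta : expR (L / 2) <= eta -> c * q ^+ 2 <= eff_dim (muhat n xs 0) eta.
  move=> eta0; rewrite -q2.
  exact: (kernel_eff_dim_lower hK n_gt0 xsX spec hbeta hp am0 mu_lb L1 Lb aL eta0 Gxs).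
have [T [stopT /andP[lo hi]]] :=
  stopping_time_rate cond nL q1 A1 upper qL c0 Lc lower.
exists T; split => //; first by rewrite qV lo hi.
apply/ereal_infP => _ [f [fC sepf] <-].
(* [eta <= b * n / q <= n] keeps the stopped scale in the range of [upper]. *)
have eta_n : 0 <= total_step (step n xs) T <= n%:R.
  rewrite (total_step_ge0 (step_ge0 cond)) (le_trans hi)//.
  by rewrite mulrCA ler_piMr ?(ltW nR0)// ler_pdivrMr// mul1r.
apply: (separation_power heps hH n_gt0 xsX spec cond q1 A0 e0 lo (upper _ eta_n) fC _ kappa1).
- have r0 : 0 <= Num.sqrt (2 * (kappa + C ^+ 2 * Num.sqrt A)) * n%:R `^ (- 2^-1) *
      L `^ (4 * p)^-1 by rewrite !mulr_ge0 ?sqrtr_ge0 ?powR_ge0.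
  have : (Num.sqrt (2 * (kappa + C ^+ 2 * Num.sqrt A)) * n%:R `^ (- 2^-1) *
      L `^ (4 * p)^-1) ^+ 2 <= emp_norm xs (ev f) ^+ 2.
    by rewrite ler_sqr ?nnegrE// (le_trans r0).
  rewrite !exprMn qsqrt sqr_sqrtr ?(ltW sep0)//.
  have -> : (n%:R `^ (- 2^-1)) ^+ 2 = n%:R^-1 :> R.
    rewrite -powR_mulrn ?powR_ge0// -powRrM mulNr mulVf ?pnatr_eq0//.
    by rewrite powR_inv1 ?ltW.
  move=> h; have := ler_wpM2l (ltW nR0) h; apply: le_trans.
  rewrite le_eqVlt; apply/orP; left; apply/eqP; field.
  by rewrite gt_eqF.
- by rewrite /kappa -/z; move: kz0 ke0; clear; lra.
- by rewrite /kappa; move: kz0; clear; lra.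
Qed.
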